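(* Let $\mathscr{O}$ be an oriented matroid of rank $k$ on the set of elements $V\sqcup\{v_0\}$ where $V$ is finite and nonempty, let $U\subseteq V$, and consider all reduced homology groups to have coefficients in a fixed field $\mathbb{F}$. Let $\mathscr{C}_{v_0,\mathscr{O}}$ be the element-avoiding complex. Then: (1) If $\mathscr{B}^+(V)\neq\emptyset$ and $\mathscr{D}^+(V)\cap\mathscr{D}^-_{v_0}=\{0\}$ then $\tilde{H}_n(\mathscr{C}_{v_0,\mathscr{O}})=0$ for $n\neq k-2$ and $\tilde{H}_{k-2}(\mathscr{C}_{v_0,\mathscr{O}})\cong\mathbb{F}$. (2) If $\mathscr{B}^+(V)=\emptyset$ or $\mathscr{D}^+(V)\cap\mathscr{D}^-_{v_0}\neq\{0\}$ then $\tilde{H}_n(\mathscr{C}_{v_0,\mathscr{O}})=0$ for all $n$. (3) If $\mathscr{D}^+(V-U)\cap\mathscr{B}^-_{v_0}=\emptyset$ then $\tilde{H}_n(\operatorname{link}_{\mathscr{C}_{v_0,\mathscr{O}}}(V-U))=0$ for all $n$. (4) If $\mathscr{D}^+(V-U)\cap\mathscr{B}^-_{v_0}\neq\emptyset$ then $\tilde{H}_n(\operatorname{link}_{\mathscr{C}_{v_0,\mathscr{O}}}(V-U))=0$ for $n\geq k-1$.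
   Context: Let $E$ be a finite set. A sign vector on $E$ is a function $\Phi\colon E\to\{-,0,+\}$; write $\Phi^{\pm}=\Phi^{-1}(\pm)$, $0$ for the zero sign vector, $(\Phi\circ\Psi)(e)=\Phi(e)$ if $\Phi(e)\ne0$ and $\Psi(e)$ otherwise, $S(\Phi,\Psi)=(\Phi^+\cap\Psi^-)\cup(\Phi^-\cap\Psi^+)$. An oriented matroid $\mathscr{O}$ on $E$ is given by its set of covectors $\mathscr{L}(\mathscr{O})$, a set of sign vectors containing $0$, closed under coordinatewise negation and $\circ$, such that for all $\Pi,\Xi\in\mathscr{L}(\mathscr{O})$ and $v\in\Pi^+\cap\Xi^-$ there is $\Theta\in\mathscr{L}(\mathscr{O})$ with $\Theta(v)=0$ and $\Theta(w)=(\Pi\circ\Xi)(w)$ for $w\in E-S(\Pi,\Xi)$. Its rank is the maximal $k$ such that there is a chain $0<\Phi_1<\dots<\Phi_k$ of covectors for the coordinatewise order induced by $0<-$, $0<+$. Vectors are the sign vectors $\Psi$ orthogonal to all covectors $\Phi$ (orthogonal: there is $v$ with $\Phi(v)=\Psi(v)\ne0$ iff there is $w$ with $\Phi(w)=-\Psi(w)\ne0$). For $U\subseteq E$, $\operatorname{conv}(U)=U\cup\{v\in E-U:\Psi^+\subseteq U,\ \Psi^-=\{v\}\text{ for some vector }\Psi\}$. For $\mathscr{O}$ on $V\sqcup\{v_0\}$, the element-avoiding complex is the simplicial complex $\mathscr{C}_{v_0,\mathscr{O}}=\{U\subseteq V:v_0\notin\operatorname{conv}(U)\}$ on ground set $V$;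 equivalently $\{U\subseteq V:\mathscr{D}^+(U)\cap\mathscr{B}^-_{v_0}\neq\emptyset\}$. Notation ($\mathfrak{s}\in\{+,-\}$): $\mathscr{B}^{\mathfrak{s}}_v=\{\Phi\in\mathscr{L}(\mathscr{O}):\Phi(v)=\mathfrak{s}\}$, $\mathscr{D}^{\mathfrak{s}}_v=\{\Phi\in\mathscr{L}(\mathscr{O}):\Phi(v)\in\{0,\mathfrak{s}\}\}$, $\mathscr{B}^{\mathfrak{s}}(U)=\bigcap_{u\in U}\mathscr{B}^{\mathfrak{s}}_u$, $\mathscr{D}^{\mathfrak{s}}(U)=\bigcap_{u\in U}\mathscr{D}^{\mathfrak{s}}_u$ (equal to $\mathscr{L}(\mathscr{O})$ for $U=\emptyset$). $\operatorname{link}_{\mathscr{X}}(\sigma)=\{\tau\in\mathscr{X}:\tau\cap\sigma=\emptyset,\tau\cup\sigma\in\mathscr{X}\}$. The void complex $\emptyset$ has vanishing reduced homology in all degrees by convention; the empty complex $\{\emptyset\}$ has $\tilde H_{-1}\cong\mathbb{F}$. *)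

(* Defs.v *)
From HB Require Import structures.
From mathcomp Require Import all_boot all_order all_algebra.
From mathcomp Require Import ring_quotient.

Set Implicit Arguments.
Unset Strict Implicit.
Unset Printing Implicit Defensive.

Import GRing.Theory.
Local Open Scope ring_scope.

Inductive sign : Type := SNeg | SZero | SPos.

Definition sign_code (s : sign) : option bool :=
  match s with SNeg => Some false | SZero => None | SPos => Some true end.
Definition sign_decode (o : option bool) : sign :=
  match o with Some false => SNeg | None => SZero | Some true => SPos end.
Lemma sign_codeK : cancel sign_code sign_decode.
Proof. by case. Qed.

HB.instance Definition _ := Finite.copy sign (can_type sign_codeK).

Definition sopp (s : sign) : sign :=
  match s with SNeg => SPos | SZero => SZero | SPos => SNeg end.

Definition signvec (E : finType) : finType := {ffun E -> sign}.

Section SignVectors.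
Variable E : finType.
Implicit Types Phi Psi : signvec E.

Definition svzero : signvec E := [ffun=> SZero].
Definition svopp Phi : signvec E := [ffun e => sopp (Phi e)].
Definition svcomp Phi Psi : signvec E :=
  [ffun e => if Phi e != SZero then Phi e else Psi e].
Definition svpos Phi : {set E} := [set e | Phi e == SPos].
Definition svneg Phi : {set E} := [set e | Phi e == SNeg].
Definition svsep Phi Psi : {set E} :=
  (svpos Phi :&: svneg Psi) :|: (svneg Phi :&: svpos Psi).

(* The coordinatewise order induced by 0 < - and 0 < +. *)
Definition svle Phi Psi : bool :=
  [forall e, (Phi e == SZero) || (Phi e == Psi e)].
Definition svlt Phi Psi : bool := (Phi != Psi) && svle Phi Psi.

Definition svorth Phi Psi : bool :=
  [exists v, (Phi v == Psi v) && (Psi v != SZero)]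
    == [exists w, (Phi w == sopp (Psi w)) && (Psi w != SZero)].

Lemma svlt_irr : irreflexive svlt.
Proof. by move=> Phi; rewrite /svlt eqxx. Qed.

Lemma svle_trans : transitive svle.
Proof.
move=> Psi Phi Xi /forallP h1 /forallP h2; apply/forallP => e.
case/orP: (h1 e) => [-> //|/eqP ->]; exact: h2.
Qed.

Lemma svle_anti : antisymmetric svle.
Proof.
move=> Phi Psi /andP[/forallP h1 /forallP h2]; apply/ffunP => e.
have := h1 e; have := h2 e.
by case/orP => /eqP h; case/orP => /eqP h'; rewrite ?h ?h'.
Qed.

Lemma svlt_trans : transitive svlt.
Proof.
move=> Psi Phi Xi /andP[n1 h1] /andP[_ h2]; apply/andP; split.
  apply: contraNneq n1 => eq; apply/eqP/svle_anti.
  by rewrite h1 eq h2.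
exact: svle_trans h1 h2.
Qed.

End SignVectors.

Record orientedMatroid (E : finType) := OrientedMatroid {
  covectors :> {set signvec E};
  covector0 : svzero E \in covectors;
  covector_opp : forall Phi, Phi \in covectors -> svopp Phi \in covectors;
  covector_comp : forall Phi Psi, Phi \in covectors -> Psi \in covectors ->
        svcomp Phi Psi \in covectors;
  covector_elim : forall (Pi Xi : signvec E) (v : E),
        Pi \in covectors -> Xi \in covectors -> v \in svpos Pi :&: svneg Xi ->
        exists Theta : signvec E,
          [/\ Theta \in covectors, Theta v = SZero
            & forall w, w \notin svsep Pi Xi -> Theta w = svcomp Pi Xi w]
}.

Section OrientedMatroidTheory.
Variables (E : finType) (O : orientedMatroid E).

(* There is a chain 0 < Phi_1 < ... < Phi_k of covectors. *)
Definition covector_chain (k : nat) : bool :=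
  [exists t : k.-tuple (signvec E),
     path (@svlt E) (svzero E) t && all [in covectors O] t].

Lemma covector_chain0 : exists k, covector_chain k.
Proof. by exists 0%N; apply/existsP; exists [tuple]. Qed.

Lemma covector_chain_bound k : covector_chain k -> (k <= #|signvec E|)%N.
Proof.
case/existsP => t /andP[pt _].
have ut : uniq t.
  have : sorted (@svlt E) t by case: (tval t) pt => //= x s /andP[].
  exact: sorted_uniq (@svlt_trans E) (@svlt_irr E) t.
by rewrite -{1}(size_tuple t) -(card_uniqP ut) max_card.
Qed.

Definition om_rank : nat := ex_maxn covector_chain0 covector_chain_bound.

Definition vectors : {set signvec E} :=
  [set Psi | [forall Phi in covectors O, svorth Phi Psi]].

Definition conv (U : {set E}) : {set E} :=
  U :|: [set v | (v \notin U) &&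
                 [exists Psi in vectors,
                    (svpos Psi \subset U) && (svneg Psi == [set v])]].

(* Only used at s = SPos and s = SNeg. *)
Definition Bset (s : sign) (v : E) : {set signvec E} :=
  [set Phi in covectors O | Phi v == s].
Definition Dset (s : sign) (v : E) : {set signvec E} :=
  [set Phi in covectors O | (Phi v == SZero) || (Phi v == s)].

(* Intersecting with the covectors makes both equal to L(O) at U = set0. *)
Definition Bcap (s : sign) (U : {set E}) : {set signvec E} :=
  covectors O :&: \bigcap_(u in U) Bset s u.
Definition Dcap (s : sign) (U : {set E}) : {set signvec E} :=
  covectors O :&: \bigcap_(u in U) Dset s u.

End OrientedMatroidTheory.

(* Both the void complex set0 and the empty complex [set set0] are allowed. *)
Record simplicialComplex (V : finType) := SimplicialComplex {
  faces :> {set {set V}};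
  faces_closed : forall s t : {set V}, s \in faces -> t \subset s -> t \in faces
}.

Section Link.
Variables (V : finType) (X : simplicialComplex V) (s : {set V}).

Definition link_faces : {set {set V}} :=
  [set t in faces X | (t :&: s == set0) && (t :|: s \in faces X)].

Lemma link_closed (t t' : {set V}) :
  t \in link_faces -> t' \subset t -> t' \in link_faces.
Proof.
rewrite !inE => /and3P[tX ts tsX] t't.
rewrite (faces_closed tX t't) (faces_closed tsX (setSU _ t't)) andbT /=.
by rewrite -subset0 -(eqP ts) setSI.
Qed.

Definition link : simplicialComplex V := SimplicialComplex link_closed.

End Link.

(* The ground set V + {v_0} is [option V], with v_0 = None; a subset U of V is
   identified with Some @: U. *)
Section ElementAvoiding.
Variables (V : finType) (O : orientedMatroid (option V)).

Definition ground (U : {set V}) : {set option V} := [set Some u | u in U].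

Definition avoiding_faces : {set {set V}} :=
  [set U | None \notin conv O (ground U)].

Lemma avoiding_closed (U U' : {set V}) :
  U \in avoiding_faces -> U' \subset U -> U' \in avoiding_faces.
Proof.
rewrite !inE => + sU; apply: contra.
have noneN W : None \in ground W = false by apply/negP => /imsetP[].
rewrite !noneN /= => /exists_inP[Psi vPsi /andP[pPsi nPsi]].
apply/exists_inP; exists Psi => //; rewrite nPsi andbT.
exact: subset_trans pPsi (imsetS _ sU).
Qed.

Definition avoiding : simplicialComplex V := SimplicialComplex avoiding_closed.

End ElementAvoiding.

Section VectorQuotient.
Variables (F : fieldType) (vT : vectType F) (U : {vspace vT}).

Let Uz : zmodClosed vT := pred_of_vspace U.

Definition vquot : Type := Quotient.quot Uz.
HB.instance Definition _ := GRing.Zmodule.on vquot.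
HB.instance Definition _ := EqQuotient.on vquot.

Definition vquot_pi (x : vT) : vquot := \pi_(Quotient.quot Uz)%qT x.
Definition vquot_repr (q : vquot) : vT := repr (q : Quotient.quot Uz).

Lemma vquot_reprK q : vquot_pi (vquot_repr q) = q.
Proof. exact: reprK. Qed.

Lemma vquot_piP x y : reflect (vquot_pi x = vquot_pi y) (x - y \in U).
Proof.
have -> : (x - y \in U) = (vquot_pi x == vquot_pi y).
  exact: (@Quotient.idealrBE _ Uz).
exact: eqP.
Qed.

Lemma vquot_piD x y : vquot_pi (x + y) = vquot_pi x + vquot_pi y.
Proof. exact: (@Quotient.pi_add _ Uz). Qed.

Definition vquot_scale (a : F) (q : vquot) : vquot :=
  vquot_pi (a *: vquot_repr q).

Lemma vquot_piZ a x : vquot_pi (a *: x) = vquot_scale a (vquot_pi x).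
Proof.
apply/vquot_piP; rewrite -scalerBr rpredZ //; apply/vquot_piP.
by rewrite vquot_reprK.
Qed.

Fact vquot_scaleA a b q :
  vquot_scale a (vquot_scale b q) = vquot_scale (a * b) q.
Proof. by rewrite -[q]vquot_reprK -!vquot_piZ scalerA. Qed.

Fact vquot_scale1 : left_id 1 vquot_scale.
Proof. by move=> q; rewrite -[q]vquot_reprK -vquot_piZ scale1r. Qed.

Fact vquot_scaleDr : right_distributive vquot_scale +%R.
Proof.
move=> a p q; rewrite -[p]vquot_reprK -[q]vquot_reprK.
by rewrite -vquot_piD -!vquot_piZ scalerDr vquot_piD.
Qed.

Fact vquot_scaleDl q : {morph vquot_scale^~ q : a b / a + b}.
Proof.
by move=> a b /=; rewrite -[q]vquot_reprK -!vquot_piZ scalerDl vquot_piD.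
Qed.

HB.instance Definition _ := GRing.Zmodule_isLmodule.Build F vquot
  vquot_scaleA vquot_scale1 vquot_scaleDr vquot_scaleDl.

Lemma vquot_pi_is_linear : linear vquot_pi.
Proof. by move=> a x y; rewrite vquot_piD vquot_piZ. Qed.

HB.instance Definition _ :=
  GRing.isLinear.Build F vT vquot *:%R vquot_pi vquot_pi_is_linear.

End VectorQuotient.

(* All chain groups live in the space of functions {set V} -> F, whose basis
   vector at s stands for the simplex s oriented by the order of [enum V]. *)
Section Homology.
Variables (F : fieldType) (V : finType).

Definition chain_space : vectType F := {ffun {set V} -> F^o}.

Definition simplex (s : {set V}) : chain_space := [ffun t => (t == s)%:R].

Definition vpos (s : {set V}) (v : V) : nat :=
  #|[set u in s | (enum_rank u < enum_rank v)%N]|.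

(* For s = [set v] the result is the simplex set0 of degree -1: this is the
   augmentation of the reduced complex. *)
Definition simplex_boundary (s : {set V}) : chain_space :=
  \sum_(v in s) (-1) ^+ vpos s v *: simplex (s :\ v).

Definition boundary (c : chain_space) : chain_space :=
  \sum_(s : {set V}) (c s : F) *: simplex_boundary s.

Lemma boundary_is_linear : linear boundary.
Proof.
move=> a c d; rewrite /boundary scaler_sumr -big_split /=.
by apply: eq_bigr => s _; rewrite !ffunE scalerDl scalerA.
Qed.

HB.instance Definition _ :=
  GRing.isLinear.Build F chain_space chain_space *:%R boundary
    boundary_is_linear.

Lemma boundary_simplex s : boundary (simplex s) = simplex_boundary s.
Proof.
rewrite /boundary (bigD1 s) //= ffunE eqxx scale1r big1 ?addr0 // => t ts.
by rewrite ffunE (negPf ts) scale0r.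
Qed.

Lemma vpos_lt (s : {set V}) (u v : V) : u \in s -> v \in s ->
  (enum_rank u < enum_rank v)%N ->
  vpos (s :\ v) u = vpos s u /\ vpos s v = (vpos (s :\ u) v).+1.
Proof.
move=> us vs uv; split.
  apply: eq_card => w; rewrite !inE; case: eqP => //= ->.
  by rewrite ltnNge (ltnW uv) andbF.
rewrite /vpos (cardsD1 u) inE us uv add1n; congr _.+1.
by apply: eq_card => w; rewrite !inE andbA.
Qed.

Lemma boundary_boundary c : boundary (boundary c) = 0.
Proof.
rewrite {2}/boundary linear_sum big1 // => s _; rewrite linearZ /=.
apply/eqP; rewrite scaler_eq0; apply/orP; right; apply/eqP.
rewrite /simplex_boundary linear_sum /=.
pose T (v u : V) : chain_space :=
  ((-1) ^+ vpos s v * (-1) ^+ vpos (s :\ v) u) *: simplex (s :\ v :\ u).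
pose lt (u v : V) := (enum_rank u < enum_rank v)%N.
have E : forall v, v \in s ->
    boundary ((-1) ^+ vpos s v *: simplex (s :\ v)) =
    \sum_(u in s | lt u v) T v u + \sum_(u in s | lt v u) T v u.
  move=> v vs; rewrite linearZ /= boundary_simplex /simplex_boundary.
  rewrite scaler_sumr (bigID (fun u => lt u v)) /=; congr (_ + _).
    apply: eq_big => [u|u _]; last by rewrite scalerA.
    by rewrite !inE; case: eqP => //= ->; rewrite /lt ltnn andbF.
  apply: eq_big => [u|u _]; last by rewrite scalerA.
  rewrite !inE /lt -leqNgt [in RHS]ltn_neqAle.
  rewrite (_ : (_ == _ :> nat) = (u == v)); first by case: (u == v); rewrite ?andbF.
  by rewrite eq_sym -(inj_eq enum_rank_inj).
rewrite (eq_bigr _ E) big_split /=.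
rewrite [X in _ + X](exchange_big_dep [in s]) /=; last by move=> ? ? ? /andP[].
rewrite -big_split big1 //= => v vs.
rewrite [X in _ + X](eq_bigl (fun u => (u \in s) && lt u v)); last first.
  by move=> u; rewrite vs.
rewrite -big_split big1 //= => u /andP[us uv].
have [e1 e2] := vpos_lt us vs uv.
rewrite /T e1 e2 exprS setDDl setUC -setDDl -scalerDl.
by rewrite -mulrA mulN1r mulrC addNr scale0r.
Qed.

Variable X : simplicialComplex V.

Definition nfaces (n : int) : {set {set V}} :=
  [set s in faces X | #|s|%:Z == n + 1].

Definition chains (n : int) : {vspace chain_space} :=
  <<[seq simplex s | s in nfaces n]>>%VS.

Definition cycles (n : int) : {vspace chain_space} :=
  (chains n :&: lker (linfun boundary))%VS.

Definition boundaries (n : int) : {vspace chain_space} :=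
  (linfun boundary @: chains (n + 1)%R)%VS.

Lemma boundaries_cycles n : (boundaries n <= cycles n)%VS.
Proof.
rewrite subv_cap; apply/andP; split; last first.
  apply/subvP => _ /memv_imgP[c _ ->].
  by rewrite memv_ker !lfunE /= boundary_boundary.
rewrite /boundaries limg_span; apply/span_subvP.
move=> _ /mapP[_ /imageP[s]] /[!inE] /andP[sX /eqP sn] -> ->.
rewrite lfunE /= boundary_simplex; apply: memv_suml => v vs.
apply: memvZ; apply: memv_span; apply/imageP; exists (s :\ v) => //.
rewrite !inE; apply/andP; split.
  by exact: faces_closed sX (subsetDl _ _).
have := sn; rewrite (cardsD1 v) vs PoszD addrC => /addIr ->; exact: eqxx.
Qed.

(* The quotient of the n-cycles by the n-boundaries, the latter viewed inside
   the space of n-cycles. *)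
Definition reduced_homology (n : int) : lmodType F :=
  vquot (linfun (@vsval F chain_space (cycles n)) @^-1: boundaries n)%VS.

End Homology.

Definition lmod_trivial (R : nzRingType) (M : lmodType R) : Prop :=
  forall x : M, x = 0.

Definition lmod_iso (R : nzRingType) (M N : lmodType R) : Prop :=
  exists f : {linear M -> N}, bijective f.

(* Main.v *)
Require Import Defs.
From HB Require Import structures.
From mathcomp Require Import all_boot all_order all_algebra.
From mathcomp Require Import zify ring.

(** Let C be the element-avoiding complex on V, with base element v0, and
    call a sign vector nonnegative if it never takes the value minus.

    Farkas' lemma for oriented matroids ([painting0]) says that U is a face of
    C exactly when some covector is minus at v0 and nonnegative on U
    ([avoidingP]).  By the definition of the convex hull, U is a non-face when
    some vector is minus at v0, nonnegative on V, and zero on V - U.  The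
    vectors of O form an oriented matroid, the dual of O ([dual]); after
    reversing the sign of v0 in it, the complements of the non-faces of C are
    the sets t such that some nonnegative Psi with Psi(v0) nonzero vanishes on
    t ([nonfaces_nerve]).  This is the nerve of the facets of a
    pseudo-polyhedron, the positive cone of the dual with v0 as hyperplane at
    infinity, and it is the Alexander dual of C.  So everything reduces to the
    nerve of the facets of a positive cone.

    If the cone lies in one of the coordinate hyperplanes, or the polyhedron has
    a nonzero recession direction, the nerve carries an acyclic matching
    without critical cell ([nonfaces_unbounded]).  Otherwise the polyhedron is
    a polytope and its boundary is a sphere: there is a matching with exactly
    one critical cell ([nonfaces_bounded]).  Both rest on [nerve_visible]: the
    facets of a cone that are visible from an outside point form a family that
    can be matched completely.  It is a shelling argument: on the way from the
    cone to the outside point, the last crossed class of walls is removed, and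
    its contribution is again a visible region, in a contraction.

    Complementation turns these matchings on the nerve into matchings on the
    non-faces.  Since the full simplex is acyclic, the exact sequence of the
    pair (full simplex, C) shows that C is acyclic when there is no critical
    cell; a single critical cell with m elements gives one class of C, in
    degree m - 2.  To identify m with the rank k, the critical cell of the
    nerve comes with a basis of the dual that has one element more.  The
    complement D of this basis in V + v0 has m elements and is a basis of O: it
    is independent, whence m is at most k ([rank_ge]), and spanning, whence m
    is at least k ([rank_le]).  This proves the two claims about C itself.

    For a subset W of V the same argument, with independence alone, shows that
    the restriction of C to W has no homology in degrees at least k - 1
    ([star0_acyclic_rank]).  A complex with this property for all W, a Leray
    complex, has the same property for all its links, by induction on the face
    whose link is taken and the exact sequence of deletion and link
    ([star_acyclic_rank]).  This is the claim about the link of a face; the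
    link of a non-face is void.

    The exact sequences are used for families of sets that are merely convex
    for inclusion, with the boundary restricted to the family.  A star is such
    a family, which makes it unnecessary to orient links until the very end
    ([acyclic_join]). *)

Set Implicit Arguments.
Unset Strict Implicit.
Unset Printing Implicit Defensive.

Import GRing.Theory.

(** * Orthogonality, minors and duality of oriented matroids *)

Lemma soppK : involutive sopp. Proof. by case. Qed.

Lemma sopp_eq0 s : (sopp s == SZero) = (s == SZero).
Proof. by case: s. Qed.

Section Orthogonality.
Variable E : finType.
Implicit Types (Phi Psi X : signvec E) (Z : {set E}).

Definition supp X : {set E} := [set e | X e != SZero].

Definition vanishes X Z : bool := [forall e in Z, X e == SZero].

Lemma vanishesP X Z : reflect (forall e, e \in Z -> X e = SZero) (vanishes X Z).
Proof. by apply: (iffP 'forall_in_eqP). Qed.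

Lemma supp_eq0 X : (forall e, X e = SZero) -> X = svzero E.
Proof. by move=> h; apply/ffunP => e; rewrite h ffunE. Qed.

Lemma svcompE Phi Psi e :
  svcomp Phi Psi e = if Phi e != SZero then Phi e else Psi e.
Proof. by rewrite ffunE. Qed.

Lemma svoppE Phi e : svopp Phi e = sopp (Phi e).
Proof. by rewrite ffunE. Qed.

Lemma svorthP Phi Psi :
  reflect ((exists v, Phi v = Psi v /\ Psi v <> SZero) <->
           (exists v, Phi v = sopp (Psi v) /\ Psi v <> SZero))
          (svorth Phi Psi).
Proof.
have b1 : reflect (exists v, Phi v = Psi v /\ Psi v <> SZero)
    [exists v, (Phi v == Psi v) && (Psi v != SZero)].
  apply: (iffP existsP) => -[v].
    by case/andP => /eqP h /eqP h'; exists v.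
  by case=> h /eqP h'; exists v; rewrite h eqxx.
have b2 : reflect (exists v, Phi v = sopp (Psi v) /\ Psi v <> SZero)
    [exists v, (Phi v == sopp (Psi v)) && (Psi v != SZero)].
  apply: (iffP existsP) => -[v].
    by case/andP => /eqP h /eqP h'; exists v.
  by case=> h /eqP h'; exists v; rewrite h eqxx.
rewrite /svorth; apply: (iffP eqP) => [h|[h1 h2]].
  split=> [/b1|/b2]; first by rewrite h => /b2.
  by rewrite -h => /b1.
by apply/idP/idP => [/b1/h1/b2|/b2/h2/b1].
Qed.

Lemma svorth_sym Phi Psi : svorth Phi Psi -> svorth Psi Phi.
Proof.
move=> /svorthP[h1 h2]; apply/svorthP; split.
  case=> v [e n]; have /h1[w [e' n']] : exists v, Phi v = Psi v /\ Psi v <> SZero.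
    by exists v; rewrite e.
  by exists w; rewrite e' soppK; split=> //; case: (Psi w) n'.
case=> v [e n]; have /h2[w [e' n']] :
    exists v, Phi v = sopp (Psi v) /\ Psi v <> SZero.
  by exists v; rewrite e soppK; split=> //; case: (Phi v) n.
by exists w; rewrite e'.
Qed.

Lemma svorth_opp Phi Psi : svorth Phi Psi -> svorth (svopp Phi) Psi.
Proof.
move=> /svorthP[h1 h2]; apply/svorthP; split=> -[v [e n]].
  have /h2[w [e' n']] : exists v, Phi v = sopp (Psi v) /\ Psi v <> SZero.
    by exists v; rewrite -e svoppE soppK -(soppK (Phi v)) -svoppE e; split=> //; case: (Psi v) n.
  by exists w; rewrite svoppE e'.
have /h1[w [e' n']] : exists v, Phi v = Psi v /\ Psi v <> SZero.
  by exists v; split=> //; move: e; rewrite svoppE => /(can_inj soppK).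
by exists w; rewrite svoppE e' soppK.
Qed.

(** The form in which orthogonality is used throughout: once disagreement is
    excluded everywhere, agreement is excluded too. *)
Lemma svorth_agree Phi Psi e : svorth Phi Psi ->
    (forall f, Phi f = SZero \/ Psi f = SZero \/ Phi f = Psi f) ->
  Phi e = SZero \/ Psi e = SZero.
Proof.
move=> /svorthP[h1 _] h; have := h e; case=> [|[]]; [by left|by right|].
case: (Psi e =P SZero) => [|n ee]; first by right.
have /h1[v [ev nv]] : exists v, Phi v = Psi v /\ Psi v <> SZero by exists e.
by have := h v; rewrite ev; case: (Psi v) nv => // _ [|[]].
Qed.

Lemma svorth_at Phi Psi e : svorth Phi Psi ->
    (forall f, f != e -> Phi f = SZero \/ Psi f = SZero) ->
  Phi e = SZero \/ Psi e = SZero.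
Proof.
move=> o h; case: (Phi e =P Psi e) => [ee|ne].
  apply: (svorth_agree e o) => f.
  by case: (eqVneq f e) => [->|/h]; tauto.
suff: svopp Phi e = SZero \/ Psi e = SZero 
  by rewrite svoppE => -[/eqP|->]; [rewrite sopp_eq0 => /eqP ->; left|right].
apply: (svorth_agree e (svorth_opp o)) => f; rewrite svoppE.
case: (eqVneq f e) => [->|/h [->|]]; [|by left|by tauto].
by case: (Phi e) ne; case: (Psi e); tauto.
Qed.

Lemma svorth_ext Phi Psi Psi' : (forall e, Phi e = SZero \/ Psi e = Psi' e) ->
  svorth Phi Psi -> svorth Phi Psi'.
Proof.
move=> h; suff eq v : (Psi' v != SZero) &&
    ((Phi v == Psi' v) || (Phi v == sopp (Psi' v))) -> Psi v = Psi' v.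
  have eq' v : (Psi v != SZero) &&
      ((Phi v == Psi v) || (Phi v == sopp (Psi v))) -> Psi' v = Psi v.
    by case: (h v) => [->|->] //; case: (Psi v).
  move=> /svorthP[h1 h2]; apply/svorthP; split=> -[v [ev nv]].
    have evv : Psi v = Psi' v by apply: eq; rewrite ev eqxx andbT; apply/eqP.
    have [|w [ew nw]] := h1; first by exists v; rewrite evv.
    by exists w; rewrite eq' // ew eqxx orbT andbT; apply/eqP.
  have evv : Psi v = Psi' v by apply: eq; rewrite ev eqxx orbT andbT; apply/eqP.
  have [|w [ew nw]] := h2; first by exists v; rewrite evv.
  by exists w; rewrite eq' // ew eqxx andbT; apply/eqP.
by case: (h v) => [->|->] //; case: (Psi' v).
Qed.

Lemma svorth_disj Phi Psi :
  (forall e, Phi e = SZero \/ Psi e = SZero) -> svorth Phi Psi.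
Proof.
move=> h; apply/svorthP; split=> -[v [ev nv]].
  by case: (h v) => // e; case: nv; rewrite -ev.
by have := h v; rewrite ev; case: (Psi v) nv => // _ [].
Qed.

(** Failure of orthogonality is one-sided, so negating one of the two vectors
    leaves only the case of agreement. *)
Lemma svorthN Phi Psi : ~~ svorth Phi Psi ->
  exists2 Phi' : signvec E, Phi' = Phi \/ Phi' = svopp Phi &
    (forall e, Phi' e = SZero \/ Psi e = SZero \/ Phi' e = Psi e) /\
    exists2 e, Phi' e = Psi e & Psi e <> SZero.
Proof.
rewrite /svorth => h.
have [/existsP[v /andP[/eqP ev /eqP nv]]|n1] :=
  boolP [exists v, (Phi v == Psi v) && (Psi v != SZero)].
  exists Phi; first by left.
  split; last by exists v.
  move=> e; move: h; rewrite (_ : [exists v, _]); last first.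
    by apply/existsP; exists v; rewrite ev eqxx; apply/eqP.
  rewrite eq_sym eqb_id => /existsPn/(_ e).
  by case: (Phi e) => //; case: (Psi e) => //; tauto.
move: h; rewrite (negPf n1) /= => h.
have /existsP[v /andP[/eqP ev /eqP nv]] :
   [exists v, (Phi v == sopp (Psi v)) && (Psi v != SZero)].
  by apply: contraNT h => /negPf ->.
exists (svopp Phi); first by right.
split; last by exists v => //; rewrite svoppE ev soppK.
move/existsPn: n1 => n1 e; have := n1 e; rewrite svoppE.
by case: (Phi e) => //; case: (Psi e) => //; tauto.
Qed.

End Orthogonality.

Section Minors.
Variable E : finType.
Implicit Types (O : orientedMatroid E) (Phi Psi X sigma : signvec E).
Implicit Types (Z : {set E}).

(** The axiom fixes the signs of the two covectors at [v]; exchanging them is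
    harmless because off the separation set they commute under composition. *)
Lemma om_elim O Pi Xi v : Pi \in O -> Xi \in O ->
    Pi v = sopp (Xi v) -> Xi v <> SZero ->
  exists2 Theta, Theta \in O & Theta v = SZero /\
    forall w, Pi w = SZero \/ Xi w = SZero \/ Pi w = Xi w ->
       Theta w = svcomp Pi Xi w.
Proof.
move=> pO xO e n.
have key (P Q : signvec E) w :
    P w = SZero \/ Q w = SZero \/ P w = Q w -> w \notin svsep P Q.
  by rewrite !inE; case: (P w); case: (Q w) => // -[|[]].
case E1 : (Xi v) n => // _.
  have [|T [h1 h2 h3]] := covector_elim pO xO (v := v).
    by rewrite !inE e E1.
  by exists T => //; split=> // w hw; rewrite h3 ?key.
have [|T [h1 h2 h3]] := covector_elim xO pO (v := v).
  by rewrite !inE e E1.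
exists T => //; split=> // w hw; rewrite h3; last by apply: key; intuition congruence.
by rewrite !svcompE; case: (Pi w) hw; case: (Xi w) => // -[|[]].
Qed.

Section Contract.
Variables (O : orientedMatroid E) (Z : {set E}).
Definition contract_set : {set signvec E} := [set Phi in O | vanishes Phi Z].

Fact contract0 : svzero E \in contract_set.
Proof. by rewrite inE covector0; apply/vanishesP => e _; rewrite ffunE. Qed.

Fact contract_opp Phi : Phi \in contract_set -> svopp Phi \in contract_set.
Proof.
rewrite !inE => /andP[/covector_opp -> /vanishesP h].
by apply/vanishesP => e /h; rewrite svoppE => ->.
Qed.

Fact contract_comp Phi Psi : Phi \in contract_set -> Psi \in contract_set ->
  svcomp Phi Psi \in contract_set.
Proof.
rewrite !inE => /andP[h1 /vanishesP h2] /andP[h3 /vanishesP h4].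
rewrite covector_comp //; apply/vanishesP => e eZ.
by rewrite svcompE h2 //= h4.
Qed.

Fact contract_elim (Pi Xi : signvec E) v :
  Pi \in contract_set -> Xi \in contract_set -> v \in svpos Pi :&: svneg Xi ->
  exists Theta : signvec E, [/\ Theta \in contract_set, Theta v = SZero
    & forall w, w \notin svsep Pi Xi -> Theta w = svcomp Pi Xi w].
Proof.
rewrite !inE => /andP[h1 /vanishesP h2] /andP[h3 /vanishesP h4] hv.
have [|T [h5 h6 h7]] := covector_elim h1 h3 (v := v); first by rewrite !inE.
exists T; split=> //; rewrite inE h5; apply/vanishesP => e eZ.
rewrite h7 ?svcompE ?h2 ?h4 //.
by rewrite !inE h2 // h4.
Qed.

(** Contraction kept on the ground set [E]: the elements of [Z] turn into
    loops.  All minors below live on the same type. *)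
Definition contract : orientedMatroid E :=
  OrientedMatroid contract0 contract_opp contract_comp contract_elim.

Lemma in_contract Phi : (Phi \in contract) = (Phi \in O) && vanishes Phi Z.
Proof. by rewrite inE. Qed.
End Contract.

Definition contract1 O e := contract O [set e].

Lemma in_contract1 O e Phi :
  (Phi \in contract1 O e) = (Phi \in O) && (Phi e == SZero).
Proof.
rewrite in_contract; congr andb; apply/vanishesP/eqP => [h|h f].
  exact/h/set11.
by rewrite inE => /eqP ->.
Qed.

Lemma vectorsP O Psi :
  reflect (forall Phi, Phi \in O -> svorth Phi Psi) (Psi \in vectors O).
Proof. by rewrite inE; apply: (iffP forall_inP). Qed.

Lemma covector_oppE O Phi : (svopp Phi \in O) = (Phi \in O).
Proof.
apply/idP/idP => [/covector_opp|]; last exact: covector_opp.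
suff -> : svopp (svopp Phi) = Phi by [].
by apply/ffunP => e; rewrite !svoppE soppK.
Qed.

Definition update X e s : signvec E := [ffun f => if f == e then s else X f].

(** If 0 is a wrong value at [e], a covector [Q0] witnesses it by agreeing with
    [X] off [e], and then only the sign opposite to [Q0 e] is possible.  A
    covector against that sign is opposite to [Q0] at [e], and eliminating
    [e] between the two gives a covector of the contraction that contradicts
    the assumption on [X]. *)
Lemma vector_lift O e X : X \in vectors (contract1 O e) ->
  exists s, update X e s \in vectors O.
Proof.
move=> hX.
have uE s f : update X e s f = if f == e then s else X f by rewrite ffunE.
have [h0|/vectorsP h0] := boolP (update X e SZero \in vectors O).
  by exists SZero.
have [Phi PO PN] : exists2 Phi, Phi \in O & ~~ svorth Phi (update X e SZero).
  case: (pickP (fun Phi => (Phi \in O) && ~~ svorth Phi (update X e SZero))).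
    by move=> P /andP[]; exists P.
  by move=> h; case: h0 => P PO; have := h P; rewrite /= PO => /negbFE.
have [Q0 hQ0 [aQ0 [f0 ef0 nf0]]] := svorthN PN.
have Q0O : Q0 \in O by case: hQ0 => -> //; rewrite covector_oppE.
have {}aQ0 f : f != e -> Q0 f = SZero \/ X f = SZero \/ Q0 f = X f.
  by move=> /negPf fe; have := aQ0 f; rewrite uE fe.
move: ef0 nf0; rewrite uE; case: eqP => // /eqP f0e ef0 nf0.
have nQe : Q0 e <> SZero.
  move=> z; have /vectorsP/(_ Q0) := hX; rewrite in_contract1 Q0O z eqxx => /(_ isT) o.
  have [|zf|//] := svorth_agree f0 o; last by apply: nf0; rewrite -ef0.
  by move=> f; case: (eqVneq f e) => [->|/aQ0 //]; left.
exists (sopp (Q0 e)); apply/vectorsP => R RO; apply/negP => /negP RN.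
have [Q hQ [aQ [f1 ef1 nf1]]] := svorthN RN.
have QO : Q \in O by case: hQ => -> //; rewrite covector_oppE.
have aQ' f : f != e -> Q f = SZero \/ X f = SZero \/ Q f = X f.
  by move=> /negPf fe; have := aQ f; rewrite uE fe.
have Qe : Q e = sopp (Q0 e).
  have := aQ e; rewrite uE eqxx; case=> [z|[|//]]; last by case: (Q0 e) nQe.
  move: ef1 nf1; rewrite uE; case: eqP => [-> |/eqP f1e ef1 nf1].
    by rewrite z.
  have /vectorsP/(_ Q) := hX; rewrite in_contract1 QO z eqxx => /(_ isT) o.
  have [|zf|//] := svorth_agree f1 o; last by case: nf1; rewrite -ef1.
  by move=> f; case: (eqVneq f e) => [->|/aQ' //]; left.
have [T TO [Te hT]] := om_elim QO Q0O Qe nQe.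
have /vectorsP/(_ T) := hX; rewrite in_contract1 TO Te eqxx => /(_ isT) oT.
have TX f : X f <> SZero -> f != e -> T f = svcomp Q Q0 f.
  move=> nX fe; apply: hT.
  by case: (aQ0 f fe) => [|[//|->]]; [tauto|case: (aQ' f fe) => [|[//|->]]; tauto].
have [||//] := svorth_agree f0 oT.
- move=> f; case: (eqVneq f e) => [->|fe]; first by left.
  case: (X f =P SZero) => [|nX]; first by tauto.
  rewrite TX // svcompE.
  by case: eqP; [case: (aQ0 f fe); tauto| case: (aQ' f fe); tauto].
- rewrite TX // svcompE; case: (aQ' f0 f0e) => [->|[//|->]]; rewrite ?eqxx ?ef0 //.
  by case: eqP.
Qed.

Lemma vector_lift_set O Z X : X \in vectors (contract O Z) ->
  exists2 Y, Y \in vectors O & forall f, f \notin Z -> Y f = X f.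
Proof.
move En: #|Z| => n; elim: n Z En X => [|n IH] Z En X hX.
  have Z0 : Z = set0 by apply/eqP; rewrite -cards_eq0 En.
  exists X => //; apply/vectorsP => Phi PO; have /vectorsP := hX; apply.
  by rewrite in_contract PO; apply/vanishesP => f; rewrite Z0 inE.
have [e eZ] : exists e, e \in Z by apply/set0Pn; rewrite -cards_eq0 En.
have [|s hs] := @vector_lift (contract O (Z :\ e)) e X.
  apply/vectorsP => Phi; rewrite in_contract1 in_contract => /andP[/andP[PO]].
  move=> /vanishesP h /eqP Pe; have /vectorsP := hX; apply.
  rewrite in_contract PO; apply/vanishesP => f fZ.
  by case: (eqVneq f e) => [-> //|fe]; apply: h; rewrite !inE fe.
have [|Y YO hY] := IH _ _ _ hs.
  by move: En; rewrite (cardsD1 e) eZ add1n => -[].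
exists Y => // f fZ; rewrite hY ?inE ?(negPf fZ) ?andbF // ffunE.
by case: eqP fZ => // ->; rewrite eZ.
Qed.

Definition agrees (sigma : signvec E) Z X : bool :=
  [forall w in Z, (X w == SZero) || (X w == sigma w)].

Lemma agreesP sigma Z X :
  reflect (forall w, w \in Z -> X w = SZero \/ X w = sigma w) (agrees sigma Z X).
Proof.
apply: (iffP forall_inP) => h w /h; first by case/orP => /eqP; tauto.
by case=> ->; rewrite eqxx ?orbT.
Qed.

(** Farkas' lemma.  Drop a second element [f] of the support of [sigma].  If
    the smaller problem has a covector, that covector has the wrong sign at
    [f]; solving the problem in the contraction of [f] and lifting the vector,
    orthogonality to that covector forces the right sign at [f]. *)
Lemma painting0 O (sigma : signvec E) e : sigma e != SZero ->
    ~~ [exists Phi in O, (Phi e == sigma e) && agrees sigma (supp sigma) Phi] ->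
  exists2 Psi, Psi \in vectors O & Psi e = sigma e /\ agrees sigma setT Psi.
Proof.
move En: #|supp sigma| => n; elim: n O sigma En => [|n IH] O sigma En ne hP.
  have : e \in supp sigma by rewrite inE.
  by rewrite (cards0_eq En) inE.
case: (pickP (fun f => (f \in supp sigma) && (f != e))) => [f /andP[fs fe]|h0].
  pose sigma' := update sigma f SZero.
  have s'E w : sigma' w = if w == f then SZero else sigma w by rewrite ffunE.
  have En' : #|supp sigma'| = n.
    move: En; rewrite (cardsD1 f) fs add1n => -[] <-.
    by apply: eq_card => w; rewrite !inE s'E; case: (w == f).
  have s'e : sigma' e = sigma e by rewrite s'E eq_sym (negPf fe).
  have ne' : sigma' e != SZero by rewrite s'e.
  have [/exists_inP[P1 P1O /andP[/eqP P1e /agreesP P1c]]|n1] := boolP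
    [exists Phi in O, (Phi e == sigma' e) && agrees sigma' (supp sigma') Phi];
    last first.
    have [Psi PV [Pe /agreesP Pc]] := IH O sigma' En' ne' n1.
    exists Psi => //; rewrite -s'e; split=> //; apply/agreesP => w wT.
    by have := Pc w wT; rewrite s'E; case: eqP => _ []; tauto.
  have {}P1c w : w != f -> sigma w <> SZero -> P1 w = SZero \/ P1 w = sigma w.
    move=> /negPf wf /eqP nw; have := P1c w; rewrite inE s'E wf; exact.
  have P1f : P1 f = sopp (sigma f).
    apply/eqP; apply: contraNT hP => nf; apply/exists_inP; exists P1 => //.
    rewrite P1e s'e eqxx; apply/agreesP => w; rewrite inE => /eqP nw.
    case: (eqVneq w f) => [->|/P1c /(_ nw) //].
    by move: nf fs; rewrite inE; case: (P1 f); case: (sigma f) => //; tauto.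
  have [|Psi PV [Pe /agreesP Pc]] := IH (contract1 O f) sigma' En' ne'.
    apply: contraNN hP => /exists_inP[Phi].
    rewrite in_contract1 => /andP[PO /eqP Pf] /andP[/eqP Pe /agreesP Pc].
    apply/exists_inP; exists Phi => //; rewrite Pe s'e eqxx.
    apply/agreesP => w; rewrite inE => nw.
    case: (eqVneq w f) => [->|/negPf wf]; first by left.
    by have := Pc w; rewrite inE s'E wf; apply.
  have [s sV] := vector_lift PV.
  have uE w : update Psi f s w = if w == f then s else Psi w by rewrite ffunE.
  have ue : update Psi f s e = sigma e by rewrite uE eq_sym (negPf fe) Pe s'e.
  exists (update Psi f s) => //; split=> //.
  (* The lifted vector is orthogonal to P1, and they agree at e, so they must
     disagree at f *)
  have sf : s = sigma f.
    move/vectorsP/(_ P1 P1O): sV => o.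
    case: (s =P sigma f) => // ns.
    have [||] := svorth_agree e o; last 2 first.
    - by rewrite P1e s'e => z; rewrite z in ne.
    - by rewrite ue => z; rewrite z in ne.
    move=> w; rewrite uE; case: eqP => [->|/eqP wf].
      by move: fs; rewrite inE P1f; case: (sigma f) ns; case: (s); tauto.
    have := Pc w (in_setT w); rewrite s'E (negPf wf) => -[->|->]; first by tauto.
    by have := P1c w wf; case: (sigma w =P SZero); tauto.
  apply/agreesP => w wT; rewrite uE; case: eqP => [->|/eqP wf]; first by right.
  by have := Pc w wT; rewrite s'E (negPf wf).
exists sigma; last by split=> //; apply/agreesP; tauto.
have se f : f != e -> sigma f = SZero.
  by move=> fe; have := h0 f; rewrite /= inE fe andbT => /negbFE/eqP.
apply/vectorsP => Phi PO; apply: svorth_disj => f.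
case: (eqVneq f e) => [->|/se]; last by right.
left; apply/eqP; apply: contraNT hP => nz.
pose Phi' := if Phi e == sigma e then Phi else svopp Phi.
apply/exists_inP; exists Phi'.
  by rewrite /Phi'; case: ifP; rewrite ?covector_oppE.
have Pe : Phi' e = sigma e.
  rewrite /Phi'; case: eqP => // ; rewrite svoppE.
  by case: (Phi e) nz; case: (sigma e) ne.
rewrite Pe eqxx; apply/agreesP => w; rewrite inE.
by case: (eqVneq w e) => [->|/se ->]; first by right.
Qed.

(** Farkas' lemma with elements [Z] at which the covector is required to
    vanish, and the vector is free in return. *)
Lemma painting O (sigma : signvec E) Z e :
    [disjoint Z & supp sigma] -> sigma e != SZero ->
    ~~ [exists Phi in O, [&& vanishes Phi Z, Phi e == sigma e
                             & agrees sigma (supp sigma) Phi]] ->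
  exists2 Psi, Psi \in vectors O & Psi e = sigma e /\ agrees sigma (~: Z) Psi.
Proof.
move=> dZ ne hP.
have [|Psi PV [Pe /agreesP Pc]] := @painting0 (contract O Z) sigma e ne.
  apply: contraNN hP => /exists_inP[Phi]; rewrite in_contract.
  move=> /andP[PO PZ] h; apply/exists_inP; exists Phi => //.
  by rewrite PZ.
have [Y YV hY] := vector_lift_set PV.
exists Y => //; split.
  by rewrite hY //; apply: contraTN ne => eZ; have /disjoint_setI0 := dZ;
     move/setP/(_ e); rewrite !inE eZ /= => /negbFE ->.
by apply/agreesP => w; rewrite inE => wZ; rewrite hY //; apply: Pc.
Qed.

(** Compatible sign vectors compose to one with the union of the supports.
    Stated for a set closed under composition, because it also serves to prove
    that the vectors satisfy elimination. *)
Lemma max_agreeing (L : {set signvec E}) sigma Z : svzero E \in L ->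
    (forall X Y, X \in L -> Y \in L -> svcomp X Y \in L) ->
  exists T, [/\ T \in L, agrees sigma Z T &
    forall X w, X \in L -> agrees sigma Z X -> w \in Z -> X w != SZero ->
      T w != SZero].
Proof.
move=> L0 Lcomp.
pose ok := [pred X : signvec E | (X \in L) && agrees sigma Z X].
have ok0 : ok (svzero E).
  by rewrite /= L0; apply/agreesP => w _; rewrite ffunE; left.
case: (@arg_maxnP _ (svzero E) ok (fun X => #|supp X :&: Z|) ok0).
move=> T /andP[TL /agreesP TZ] Tmax; exists T; split=> //; first exact/agreesP.
move=> X w XL /agreesP XZ wZ nX; apply/negP => /eqP Tw.
have := Tmax (svcomp T X); rewrite /= Lcomp //=.
have -> : agrees sigma Z (svcomp T X).
  by apply/agreesP => f fZ; rewrite svcompE; case: eqP => _; [exact: XZ|exact: TZ].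
move=> /(_ isT) /=; rewrite leqNgt => /negP[]; apply: proper_card.
apply/properP; split.
  by apply/subsetP => f; rewrite !inE svcompE => /andP[h ->]; rewrite h h.
exists w; first by rewrite !inE svcompE Tw eqxx nX.
by rewrite !inE Tw eqxx.
Qed.

Section Dual.
Variable O : orientedMatroid E.

Fact dual0 : svzero E \in vectors O.
Proof. by apply/vectorsP => P _; apply: svorth_disj => e; right; rewrite ffunE. Qed.

Fact dual_opp X : X \in vectors O -> svopp X \in vectors O.
Proof.
move=> /vectorsP h; apply/vectorsP => P /h o.
exact/svorth_sym/svorth_opp/svorth_sym.
Qed.

Fact dual_comp X Y : X \in vectors O -> Y \in vectors O ->
  svcomp X Y \in vectors O.
Proof.
move=> /vectorsP hX /vectorsP hY; apply/vectorsP => P PO; apply/negP => /negP.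
case/svorthN => Q hQ [aQ [f ef nf]].
have QO : Q \in O by case: hQ => -> //; rewrite covector_oppE.
have XQ e : Q e = SZero \/ X e = SZero.
  apply: (svorth_agree _ (hX _ QO)) => w; have := aQ w; rewrite svcompE.
  by case: eqP; tauto.
have YQ e : Q e = SZero \/ Y e = SZero.
  apply: (svorth_agree _ (hY _ QO)) => w; have := aQ w; have := XQ w.
  by rewrite svcompE; case: eqP; tauto.
move: ef nf; rewrite svcompE; case: eqP (XQ f) (YQ f); intuition congruence.
Qed.

(** The vector sought is prescribed by [sigma] off the separation set [S], is
    zero at [v] and free on [S :\ v].  Painting yields, for each element of the
    support of [sigma], a vector that is nonzero there, for a covector in the
    other alternative would violate orthogonality with [Pi] or with [Xi],
    depending on its sign at [v].  The composition of these vectors is exact. *)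
Fact dual_elim (Pi Xi : signvec E) v :
  Pi \in vectors O -> Xi \in vectors O -> v \in svpos Pi :&: svneg Xi ->
  exists Theta : signvec E, [/\ Theta \in vectors O, Theta v = SZero
    & forall w, w \notin svsep Pi Xi -> Theta w = svcomp Pi Xi w].
Proof.
move=> /vectorsP pV /vectorsP xV; rewrite !inE => /andP[/eqP Pv /eqP Xv].
pose S := svsep Pi Xi.
pose sigma : signvec E := [ffun w => if w \in S then SZero else svcomp Pi Xi w].
have SE w : w \in S = [|| (Pi w == SPos) && (Xi w == SNeg)
                        | (Pi w == SNeg) && (Xi w == SPos)] by rewrite !inE.
have sE w : sigma w = if w \in S then SZero else svcomp Pi Xi w by rewrite ffunE.
have vS : v \in S by rewrite SE Pv Xv.
have sv : sigma v = SZero by rewrite sE vS.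
have sNS w : w \notin S ->
    [/\ sigma w = svcomp Pi Xi w, Pi w <> SZero -> sigma w = Pi w
      & Xi w <> SZero -> sigma w = Xi w].
  move=> wS; move: (wS); rewrite {1}SE sE (negPf wS) svcompE.
  by case: (Pi w); case: (Xi w).
have paint w0 : sigma w0 != SZero ->
    exists2 Psi, Psi \in vectors O &
      Psi w0 = sigma w0 /\ agrees sigma (~: (S :\ v)) Psi.
  move=> nw0; apply: painting => //.
    apply/pred0P => w; rewrite /= in_setD1 [w \in supp _]inE sE.
    by case: (w \in S); rewrite ?andbF.
  apply/negP => /exists_inP[Phi PO /and3P[/vanishesP Pz /eqP P0 /agreesP Pa]].
  have w0S : w0 \notin S by apply: contraNN nw0; rewrite sE => ->.
  have w0v : w0 != v by apply: contraNneq w0S => ->.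
  have {}Pa w : w \notin S -> sigma w <> SZero -> Phi w = sigma w \/ Phi w = SZero.
    by move=> _ /eqP n; have := Pa w; rewrite inE => /(_ n); tauto.
  have agP w : w != v -> Phi w = SZero \/ Pi w = SZero \/ Phi w = Pi w.
    move=> wv; case: (boolP (w \in S)) => wS; first by left; apply: Pz; rewrite in_setD1 wv.
    have [_ h _] := sNS w wS; case: (Pi w =P SZero) => [|n]; first by tauto.
    by have := Pa w wS; rewrite h //; tauto.
  have agX w : w != v -> Phi w = SZero \/ Xi w = SZero \/ Phi w = Xi w.
    move=> wv; case: (boolP (w \in S)) => wS; first by left; apply: Pz; rewrite in_setD1 wv.
    have [_ _ h] := sNS w wS; case: (Xi w =P SZero) => [|n]; first by tauto.
    by have := Pa w wS; rewrite h //; tauto.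
  have disP : Phi v <> SNeg -> forall w, Phi w = SZero \/ Pi w = SZero.
    move=> n w; apply: (svorth_agree _ (pV _ PO)) => f.
    case: (eqVneq f v) => [->|/agP //]; rewrite Pv.
    by case: (Phi v) n; tauto.
  have disX : Phi v <> SPos -> forall w, Phi w = SZero \/ Xi w = SZero.
    move=> n w; apply: (svorth_agree _ (xV _ PO)) => f.
    case: (eqVneq f v) => [->|/agX //]; rewrite Xv.
    by case: (Phi v) n; tauto.
  have Pv0 : Phi v = SZero.
    case: (Phi v =P SNeg) => [e|/disP/(_ v)]; last by rewrite Pv => -[].
    by have [||] := disX _ v; rewrite ?e ?Xv.
  have [e1 e2] : Pi w0 = SZero /\ Xi w0 = SZero.
    have nP : Phi v <> SNeg by rewrite Pv0.
    have nX : Phi v <> SPos by rewrite Pv0.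
    have nz : Phi w0 <> SZero by rewrite P0; apply/eqP.
    by have [//|->] := disP nP w0; have [//|->] := disX nX w0.
  by move: nw0; have [-> _ _] := sNS w0 w0S; rewrite svcompE e1 e2.
have [T [TV /agreesP Ta Tmax]] := max_agreeing sigma (~: (S :\ v)) dual0 dual_comp.
exists T; split=> //.
  by case: (Ta v); rewrite ?sv // in_setC in_setD1 eqxx.
move=> w wS; have [<- _ _] := sNS w wS.
have wZ : w \in ~: (S :\ v) by rewrite in_setC in_setD1 (negPf wS) andbF.
case: (Ta w wZ) => // Tw; apply/eqP; apply: contraT => nw.
have ns : sigma w != SZero by rewrite eq_sym -Tw.
have [Psi PV [Pw Pa]] := paint w ns.
by have := Tmax Psi w PV Pa wZ; rewrite Pw Tw eqxx ns => /(_ isT).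
Qed.

Definition dual : orientedMatroid E :=
  OrientedMatroid dual0 dual_opp dual_comp dual_elim.

End Dual.

Section Reorient.
Variables (O : orientedMatroid E) (N : {set E}).

Definition flip X : signvec E := [ffun e => if e \in N then sopp (X e) else X e].

Lemma flipE X e : flip X e = if e \in N then sopp (X e) else X e.
Proof. by rewrite ffunE. Qed.

Lemma flipK : involutive flip.
Proof.
by move=> X; apply/ffunP => e; rewrite !flipE; case: (e \in N); rewrite ?soppK.
Qed.

Lemma svorth_flip X Y : svorth X Y -> svorth (flip X) (flip Y).
Proof.
have eq1 v : (flip X v = flip Y v /\ flip Y v <> SZero) <->
             (X v = Y v /\ Y v <> SZero).
  by rewrite !flipE; case: (v \in N) => //; case: (X v); case: (Y v); split=> -[].
have eq2 v : (flip X v = sopp (flip Y v) /\ flip Y v <> SZero) <->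
             (X v = sopp (Y v) /\ Y v <> SZero).
  by rewrite !flipE; case: (v \in N) => //; case: (X v); case: (Y v); split=> -[].
move=> /svorthP[h1 h2]; apply/svorthP; split=> -[v].
  by move=> /eq1 hv; have [|w hw] := h1; [exists v|exists w; apply/eq2].
by move=> /eq2 hv; have [|w hw] := h2; [exists v|exists w; apply/eq1].
Qed.

(** Reorientation makes one sign convention, nonnegativity, sufficient for the
    cones that occur below. *)
Definition reorient_set : {set signvec E} := [set X | flip X \in O].

Fact reorient0 : svzero E \in reorient_set.
Proof.
rewrite inE; suff -> : flip (svzero E) = svzero E by exact: covector0.
by apply/ffunP => e; rewrite flipE ffunE; case: ifP.
Qed.

Fact reorient_opp X : X \in reorient_set -> svopp X \in reorient_set.
Proof.
rewrite !inE => /covector_opp.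
suff -> : svopp (flip X) = flip (svopp X) by [].
by apply/ffunP => e; rewrite svoppE !flipE svoppE; case: ifP.
Qed.

Fact reorient_comp X Y : X \in reorient_set -> Y \in reorient_set ->
  svcomp X Y \in reorient_set.
Proof.
rewrite !inE => hX /(covector_comp hX).
suff -> : svcomp (flip X) (flip Y) = flip (svcomp X Y) by [].
apply/ffunP => e; rewrite svcompE !flipE svcompE.
by case: (e \in N); rewrite // sopp_eq0; case: ifP.
Qed.

Fact reorient_elim (Pi Xi : signvec E) v :
  Pi \in reorient_set -> Xi \in reorient_set -> v \in svpos Pi :&: svneg Xi ->
  exists Theta : signvec E, [/\ Theta \in reorient_set, Theta v = SZero
    & forall w, w \notin svsep Pi Xi -> Theta w = svcomp Pi Xi w].
Proof.
rewrite !inE => hP hX /andP[/eqP Pv /eqP Xv].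
have [||T TO [Tv hT]] := om_elim hP hX (v := v).
- by rewrite !flipE Pv Xv; case: ifP.
- by rewrite flipE Xv; case: ifP.
exists (flip T); split; first by rewrite inE flipK.
  by rewrite flipE Tv; case: ifP.
move=> w; rewrite !inE => hw; rewrite flipE hT.
  rewrite !svcompE !flipE; case: (w \in N) => //.
  by rewrite sopp_eq0; case: ifP; rewrite soppK.
rewrite !flipE; case: (w \in N); move: hw.
  by case: (Pi w); case: (Xi w) => //; tauto.
by case: (Pi w); case: (Xi w) => //; tauto.
Qed.

Definition reorient : orientedMatroid E :=
  OrientedMatroid reorient0 reorient_opp reorient_comp reorient_elim.

Lemma in_reorient X : (X \in reorient) = (flip X \in O).
Proof. by rewrite inE. Qed.

End Reorient.

End Minors.

(** * Acyclic matchings on families of sets *)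

Section Morse.
Variable V : finType.
Implicit Types (s t : {set V}) (A B Y : {set {set V}}) (k l : seq {set V}).

Definition layered A B : Prop :=
  forall s t, s \in A -> t \in B -> ~~ (t \subset s).

(** [morse k Y]: the family [Y] has an acyclic matching in the sense of
    discrete Morse theory whose critical cells are listed in [k].  Building
    the matching layer by layer makes acyclicity automatic, and makes the
    notion symmetric under reversal of inclusion. *)
Inductive morse : seq {set V} -> {set {set V}} -> Prop :=
| morse_nil : morse [::] set0
| morse_pair t a : a \notin t -> morse [::] [set t; a |: t]
| morse_cell t : morse [:: t] [set t]
| morse_layer k l A B :
    morse k A -> morse l B -> layered A B -> morse (k ++ l) (A :|: B).

(** Match [s] with [a |: s], peeling off the pair of a largest member first. *)
Lemma morse_cone a Y : (forall s, (a |: s \in Y) = (s \in Y)) -> morse [::] Y.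
Proof.
move En: #|Y| => n; elim/ltn_ind: n Y En => n IH Y En coneY.
case: (set_0Vmem Y) => [->|[t0 t0Y]]; first exact: morse_nil.
case: (@arg_maxnP _ t0 [in Y] (fun s => #|s|) t0Y) => t /= tY tmax.
have at_ : a \in t.
  apply: contraT => nat_; have := tmax (a |: t); rewrite coneY => /(_ tY).
  by rewrite /= cardsU1 nat_ add1n ltnn.
pose P := [set t :\ a; a |: (t :\ a)].
have Pt : a |: (t :\ a) = t by rewrite setD1K.
have PY : P \subset Y.
  by apply/subsetP => s; rewrite !inE => /orP[] /eqP ->; rewrite ?Pt // -coneY Pt.
have eY : Y = (Y :\: P) :|: P by rewrite -{1}(setID Y P) (setIidPr PY) setUC.
rewrite eY -[[::]]/([::] ++ [::]).
apply: morse_layer.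
- apply: (IH #|Y :\: P|) => //.
    rewrite -En; apply: proper_card; rewrite properE subsetDl /=.
    apply/subsetPn; exists t => //; first by rewrite !inE Pt eqxx orbT.
  move=> s; rewrite !inE Pt coneY; congr andb; congr negb.
  case: (boolP (a \in s)) => [as_|nas].
    by rewrite (setUidPr _) ?sub1set.
  have -> : (a |: s == t :\ a) = false.
    by apply: contraFF (setD11 a t) => /eqP <-; apply: setU11.
  have -> : (s == t) = false by apply: contraNF nas => /eqP ->.
  by rewrite orbF; apply/eqP/eqP => [<-|->//]; rewrite setU1K.
- by apply: morse_pair; rewrite !inE eqxx.
- move=> s u; rewrite !inE Pt negb_or => /andP[/andP[n1 n2] sY].
  have nts : ~~ (t \subset s).
    apply: contraNN n2 => ts; rewrite eq_sym eqEcard ts; exact: tmax.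
  move=> /orP[] /eqP -> //; apply/negP => h.
  have tas : t \subset a |: s by rewrite -Pt setUS.
  have ets : t = a |: s.
    by apply/eqP; rewrite eqEcard tas; apply: tmax; rewrite coneY.
  case: (boolP (a \in s)) => as_.
    by move/negP: nts; apply; rewrite ets subUset sub1set as_ subxx.
  by move/negP: n1; apply; rewrite ets setU1K.
Qed.

Lemma morse_cells k Y : morse k Y -> {subset k <= Y}.
Proof.
elim=> {k Y} [|t b bt|t|k l A B _ hA _ hB _] s //.
  by rewrite inE => /eqP ->; rewrite set11.
by rewrite mem_cat in_setU => /orP[/hA|/hB] ->; rewrite ?orbT.
Qed.

Lemma morse_star a k Y : (forall t, t \in Y -> a \notin t) -> morse k Y ->
  morse [seq a |: t | t <- k] [set a |: t | t in Y].
Proof.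
move=> aY m; elim: m aY => {k Y} [|t b bt|t|k l A B _ IHA _ IHB lAB] aY.
- by rewrite imset0; apply: morse_nil.
- rewrite imsetU1 imset_set1 setUCA; apply: morse_pair.
  have := aY (b |: t); rewrite !inE eqxx orbT !negb_or eq_sym bt andbT.
  by move=> /(_ isT) /andP[].
- by rewrite imset_set1; apply: morse_cell.
rewrite map_cat imsetU; apply: morse_layer.
- by apply: IHA => t tA; apply: aY; rewrite inE tA.
- by apply: IHB => t tB; apply: aY; rewrite inE tB orbT.
move=> _ _ /imsetP[s sA ->] /imsetP[t tB ->].
apply: contra (lAB s t sA tB) => /subsetP h; apply/subsetP => x xt.
have := h x; rewrite !inE xt orbT => /(_ isT) /orP[/eqP xa|//].
by have := aY t; rewrite inE tB orbT -xa xt => /(_ isT).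
Qed.

End Morse.

Section MorseDual.
Variables (E V : finType) (i : V -> E) (i_inj : injective i) (W : {set V}).

(** Complementation in [W], combined with the passage from subsets of [E] to
    subsets of [V]; it reverses inclusion, hence the order of the layers. *)
Definition cocell (t : {set E}) : {set V} := W :\: i @^-1: t.

Lemma cocell_sub (s t : {set E}) : s \subset i @: W ->
  (cocell t \subset cocell s) = (s \subset t).
Proof.
move=> sW; apply/idP/idP => /subsetP h; apply/subsetP.
  move=> x xs; have /imsetP[v vW ev] := subsetP sW x xs.
  apply: contraT => xt; have := h v; rewrite !inE vW -ev xt => /(_ isT).
  by rewrite xs.
by move=> v; rewrite !inE => /andP[vt ->]; rewrite andbT; apply: contra vt; apply: h.
Qed.

Lemma morse_cocell k (Y : {set {set E}}) :
    (forall t, t \in Y -> t \subset i @: W) ->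
  morse k Y -> morse (rev [seq cocell t | t <- k]) [set cocell t | t in Y].
Proof.
move=> YW m; elim: m YW => {k Y} [|t b bt|t|k l A B _ IHA _ IHB lAB] YW.
- by rewrite imset0; apply: morse_nil.
- rewrite imsetU1 imset_set1.
  have := YW (b |: t); rewrite !inE eqxx orbT subUset sub1set => /(_ isT).
  case/andP => /imsetP[v vW eb] _.
  have -> : cocell t = v |: cocell (b |: t).
    apply/setP => x; rewrite !inE eb (inj_eq i_inj).
    by case: eqP => // ->; rewrite vW -eb bt.
  by rewrite setUC; apply: morse_pair; rewrite !inE eb eqxx.
- by rewrite imset_set1; apply: morse_cell.
rewrite map_cat rev_cat imsetU setUC; apply: morse_layer.
- by apply: IHB => t tB; apply: YW; rewrite inE tB orbT.
- by apply: IHA => t tA; apply: YW; rewrite inE tA.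
move=> _ _ /imsetP[t tB ->] /imsetP[s sA ->].
rewrite cocell_sub; last by apply: YW; rewrite inE tB orbT.
exact: lAB.
Qed.

End MorseDual.

(** * The facets of a positive cone *)

Section Nerve.
Variable E : finType.
Implicit Types (O : orientedMatroid E) (T X Y : signvec E) (A B t : {set E}).
Implicit Types (Q : pred (signvec E)).

Definition nonneg X : bool := [forall e, X e != SNeg].

Lemma nonnegP X : reflect (forall e, X e <> SNeg) (nonneg X).
Proof. by apply: (iffP forallP) => h e; apply/eqP; apply: h. Qed.

Lemma nonneg_comp X Y : nonneg X -> nonneg Y -> nonneg (svcomp X Y).
Proof.
move=> /nonnegP hX /nonnegP hY; apply/nonnegP => e; rewrite svcompE.
by case: ifP.
Qed.

Lemma nonneg_top O : exists T,
  [/\ T \in O, nonneg T & forall X, X \in O -> nonneg X -> supp X \subset supp T].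
Proof.
have nn X : nonneg X = agrees [ffun=> SPos] setT X.
  apply/nonnegP/agreesP => h e.
    by have := h e; rewrite ffunE; case: (X e); tauto.
  by have := h e (in_setT e); rewrite ffunE => -[] ->.
have [T [TO Ta Tmax]] := max_agreeing [ffun=> SPos] setT
  (covector0 O) (@covector_comp _ O).
exists T; split; rewrite ?nn // => X XO; rewrite nn => Xa.
by apply/subsetP => e; rewrite !inE; apply: Tmax.
Qed.

(** The nonnegative covectors are the faces of a cone with facets among the
    elements of [E], and a set [t] belongs to the nerve if the facets in [t]
    have a common face.  The predicate [Q] discards faces: the zero covector,
    or everything at infinity. *)
Definition nerve O Q A : {set {set E}} :=
  [set t : {set E} | (t \subset A) &&
     [exists X in O, [&& nonneg X, Q X & vanishes X t]]].

Lemma nerveP O Q A t :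
  reflect (t \subset A /\ exists2 X, X \in O & [/\ nonneg X, Q X & vanishes X t])
          (t \in nerve O Q A).
Proof.
rewrite inE; apply: (iffP andP) => -[tA].
  by case/exists_inP => X XO /and3P[*]; split=> //; exists X.
by case=> X XO [*]; split=> //; apply/exists_inP; exists X => //; apply/and3P.
Qed.

Lemma vanishesU X t a : vanishes X (a |: t) = (X a == SZero) && vanishes X t.
Proof.
apply/vanishesP/andP => [h|[/eqP h /vanishesP h'] f].
  by split; [rewrite h ?setU11 | apply/vanishesP => f ft; rewrite h ?inE ?ft ?orbT].
by rewrite !inE => /orP[/eqP ->|/h'].
Qed.

Lemma vanishesS X t t' : t' \subset t -> vanishes X t -> vanishes X t'.
Proof.
by move=> /subsetP s /vanishesP h; apply/vanishesP => e /s/h.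
Qed.

(** Deletion and link of the vertex [a]; the link is the nerve of the
    contraction. *)
Lemma nerve_split O Q A a k l : a \in A ->
    morse k (nerve O Q (A :\ a)) ->
    morse l (nerve (contract1 O a) Q (A :\ a)) ->
  morse (k ++ [seq a |: t | t <- l]) (nerve O Q A).
Proof.
move=> aA mk ml.
have na t : t \in nerve (contract1 O a) Q (A :\ a) -> a \notin t.
  by case/nerveP => /subsetP h _; apply/negP => /h; rewrite !inE eqxx.
have -> : nerve O Q A = nerve O Q (A :\ a) :|:
    [set a |: t | t in nerve (contract1 O a) Q (A :\ a)].
  apply/setP => t; rewrite in_setU; apply/idP/orP.
    case/nerveP => tA [X XO [nX QX Xt]]; case: (boolP (a \in t)) => ta.
      right; apply/imsetP; exists (t :\ a); last by rewrite setD1K.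
      apply/nerveP; split; first by rewrite setSD.
      exists X; last by split=> //; apply: vanishesS Xt; apply: subsetDl.
      by rewrite in_contract1 XO; apply/eqP; apply: (vanishesP _ _ Xt).
    left; apply/nerveP; split; first by rewrite subsetD1 tA.
    by exists X.
  case=> [/nerveP[tA h]|/imsetP[s /nerveP[sA [X]]]].
    by apply/nerveP; split=> //; apply: subset_trans tA (subsetDl _ _).
  rewrite in_contract1 => /andP[XO Xa] [nX QX Xs] ->.
  apply/nerveP; split.
    by rewrite subUset sub1set aA (subset_trans sA) // subsetDl.
  by exists X => //; split=> //; rewrite vanishesU Xa.
apply: morse_layer => //; first exact: morse_star.
move=> s _ /nerveP[sA _] /imsetP[t _ ->]; apply/negP => /subsetP/(_ a (setU11 _ _)).
by move/(subsetP sA); rewrite !inE eqxx.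
Qed.

Lemma nerve_cone O Q A z : z \in A ->
    (forall X, X \in O -> nonneg X -> Q X -> X z = SZero) ->
  morse [::] (nerve O Q A).
Proof.
move=> zA hz; apply: (@morse_cone _ z) => t; apply/nerveP/nerveP.
  case=> tA [X XO [nX QX]]; rewrite vanishesU => /andP[_ Xt].
  split; first by apply: subset_trans tA; apply: subsetUr.
  by exists X.
case=> tA [X XO [nX QX Xt]]; split; first by rewrite subUset sub1set zA.
by exists X => //; rewrite vanishesU (hz X) ?eqxx.
Qed.

(** A face on a wall in [B] lies on the wall [a] too, so the members of the
    nerve that meet [B] form a cone with apex [a]. *)
Lemma nerve_parallel O Q A B a k : a \in A -> a \notin B -> B \subset A ->
    (forall b X, b \in B -> X \in O -> nonneg X -> X b = SZero -> X a = SZero) ->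
  morse k (nerve O Q (A :\: B)) -> morse k (nerve O Q A).
Proof.
move=> aA aB BA par mk.
pose R := [set t in nerve O Q A | ~~ [disjoint t & B]].
have -> : nerve O Q A = nerve O Q (A :\: B) :|: R.
  apply/setP => t; rewrite in_setU [t \in R]inE; apply/idP/orP.
    move=> tN; case: (boolP [disjoint t & B]) => tB; [left|by right; rewrite tN].
    by case/nerveP: tN => tA h; apply/nerveP; rewrite subsetD tA.
  case=> [/nerveP[]|/andP[] //]; rewrite subsetD => /andP[tA _] h.
  exact/nerveP.
rewrite -[k]cats0; apply: morse_layer => //.
  apply: (@morse_cone _ a) => t.
  rewrite [LHS]inE [RHS]inE -!setI_eq0 setIUl.
  have -> : [set a] :&: B = set0 by apply/eqP; rewrite setI_eq0 disjoints1.
  rewrite set0U setI_eq0.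
  case: (boolP [disjoint t & B]); rewrite ?andbF ?andbT // => tB.
  have [b bt bB] : exists2 b, b \in t & b \in B.
    by move: tB; rewrite -setI_eq0 => /set0Pn[b] /setIP[]; exists b.
  apply/nerveP/nerveP.
    case=> tA [X XO [nX QX]]; rewrite vanishesU => /andP[_ Xt].
    split; first by apply: subset_trans tA; apply: subsetUr.
    by exists X.
  case=> tA [X XO [nX QX Xt]]; split; first by rewrite subUset sub1set aA.
  exists X => //; split=> //; rewrite vanishesU Xt andbT; apply/eqP.
  by apply: (par b) => //; apply: (vanishesP _ _ Xt).
move=> s t /nerveP[sA _]; rewrite inE => /andP[_]; apply: contra => ts.
by move: sA; rewrite subsetD => /andP[_]; apply: disjointWl.
Qed.

(** [svneg Th] are the walls that separate the point [Th] from the cone with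
    interior [T].  Crossing all of them but the class [B] that is crossed last
    leads to [X], a point on that last wall.  The walls other than [B] are
    those visible from [svcomp X T], and the link of [B] consists of the walls
    visible from [X] in the contraction, or is a cone if the face on the
    last wall lies on another of these walls.  The base case is that [B] is
    everything; then [X] is a face of the cone on all walls of [B], and [g]
    ensures that [Q] keeps it. *)
Lemma nerve_visible O Q T Th g :
    T \in O -> nonneg T ->
    (forall X, X \in O -> nonneg X -> supp X \subset supp T) ->
    Th \in O -> svneg Th != set0 -> svneg Th \subset supp T -> Th g = SPos ->
    (forall X, X \in O -> nonneg X -> X g = SPos -> Q X) ->
  morse [::] (nerve O Q (svneg Th)).
Proof.
move En: #|svneg Th| => n.
elim/ltn_ind: n O T Th En => n IH O T Th0 En TO nT Tmax Th0O A0 AT Th0g hQ.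
have {}nT e : T e <> SNeg by move: e; apply/nonnegP.
have Tpos e : T e != SZero -> T e = SPos by have := nT e; case: (T e).
pose A := svneg Th0.
have memA e : (e \in A) = (Th0 e == SNeg) by rewrite inE.
have TA e : e \in A -> T e = SPos.
  by move=> /(subsetP AT); rewrite inE => /Tpos.
have Toff X e : X \in O -> nonneg X -> T e = SZero -> X e = SZero.
  move=> XO nX Te; apply/eqP; apply: contraT => nz.
  by have /subsetP/(_ e) := Tmax X XO nX; rewrite !inE nz Te eqxx => /(_ isT).
(* Composing with T keeps the negative part; by maximality of T the supports
   become equal *)
pose Th := svcomp Th0 T.
have ThO : Th \in O by apply: covector_comp.
have ThA e : e \in A -> Th e = SNeg.
  by rewrite memA svcompE => /eqP ->.
have Thoff e : T e = SZero -> Th e = SZero.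
  move=> Te; rewrite -(Toff (svcomp T Th0) e) ?covector_comp //.
    by rewrite !svcompE Te /=; case: eqP.
  apply/nonnegP => f; rewrite svcompE; case: ifP => [_|/negbFE Tf]; first exact: nT.
  by move/eqP; rewrite -memA => /TA; rewrite (eqP Tf).
have Thpos e : e \notin A -> T e = SPos -> Th e = SPos.
  by rewrite memA svcompE => nA ->; case: (Th0 e) nA.
have Thg : Th g = SPos by rewrite svcompE Th0g.
clearbody Th.
have gA : g \notin A by rewrite memA Th0g.
have Tg : T g = SPos.
  by apply: Tpos; apply/eqP => /Thoff; rewrite Thg.
(* S collects the covectors on walls that are crossed between T and Th *)
pose S := [pred X : signvec E | [&& X \in O,
  [forall e, (e \notin A) ==> (X e == T e)] & [exists a in A, X a == SZero]]].
have SP X : X \in S -> [/\ X \in O, (forall e, e \notin A -> X e = T e)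
    & exists2 a, a \in A & X a = SZero].
  case/and3P => XO /forall_inP h1 /exists_inP[a aA /eqP h2]; split=> //.
    by move=> e /h1/eqP.
  by exists a.
have [X0 X0S] : exists X, X \in S.
  have /set0Pn[a aA] := A0.
  have [||X XO [Xa hX]] := om_elim TO ThO (v := a); rewrite ?(ThA a) ?(TA a) //.
  exists X; apply/and3P; split=> //; last by apply/exists_inP; exists a; rewrite ?Xa.
  apply/forall_inP => e eA; apply/eqP; rewrite hX 1?svcompE.
    by case: eqP => // Te; rewrite Te Thoff.
  case: (T e =P SZero) => [|/eqP/Tpos Te]; first by left.
  by right; right; rewrite Te Thpos.
case: (@arg_maxnP _ X0 [in S] (fun X => #|svneg X|) X0S) => X XS Xmax.
have {X0 X0S} [XO XT [a aA Xa]] := SP X XS.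
have Xneg : svneg X \subset A.
  apply/subsetP => e; rewrite inE => /eqP Xe; apply: contraT => /XT.
  by rewrite Xe => /esym/nT.
(* No element of A is positive in X: crossing it as well would enlarge X^- *)
have Xle e : e \in A -> X e <> SPos.
  move=> eA Xe.
  have [||Y YO [Ye hY]] := om_elim XO ThO (v := e); rewrite ?(ThA e) ?Xe //.
  have YS : Y \in S.
    apply/and3P; split=> //; last by apply/exists_inP; exists e; rewrite ?Ye.
    apply/forall_inP => f fA; apply/eqP; rewrite hY 1?svcompE XT //.
      by case: eqP => // Tf; rewrite Tf Thoff.
    case: (T f =P SZero) => [|/eqP/Tpos Tf]; first by left.
    by right; right; rewrite Tf Thpos.
  have := Xmax Y YS; rewrite /= leqNgt => /negP[]; apply: proper_card.
  apply/properP; split.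
    apply/subsetP => f fX; have fA := subsetP Xneg f fX.
    move: fX; rewrite !inE => /eqP fX.
    by rewrite hY 1?svcompE ?fX // ThA //; tauto.
  exists a; last by rewrite inE Xa.
  by rewrite inE hY ?svcompE ?Xa ?ThA //; tauto.
pose B := A :\: svneg X.
have BE b : (b \in B) = (b \in A) && (X b == SZero).
  rewrite in_setD [b \in svneg X]inE andbC.
  case: (boolP (b \in A)) => //= bA.
  by have := Xle b bA; case: (X b).
have AB : A :\: B = svneg X by rewrite setDDr setDv set0U (setIidPr Xneg).
have aB : a \in B by rewrite BE aA Xa.
(* All elements of B are zero together: otherwise perturb X by - Y *)
have par b Y : b \in B -> Y \in O -> nonneg Y -> Y b = SZero -> Y a = SZero.
  rewrite BE => /andP[bA /eqP Xb] YO nY Yb.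
  apply/eqP; apply: contraT => Ya.
  have {}Ya : Y a = SPos by move/nonnegP/(_ a): nY Ya; case: (Y a).
  pose Z := svcomp X (svopp Y).
  have ZE e : Z e = if X e != SZero then X e else sopp (Y e).
    by rewrite svcompE svoppE.
  have ZS : Z \in S.
    apply/and3P; split; first by rewrite covector_comp ?covector_opp.
      apply/forall_inP => e eA; apply/eqP; rewrite ZE XT //; case: eqP => // Te.
      by rewrite Te (Toff Y).
    by apply/exists_inP; exists b; rewrite // ZE Xb Yb.
  have := Xmax Z ZS; rewrite /= leqNgt => /negP[]; apply: proper_card.
  apply/properP; split; last by exists a; rewrite inE ?ZE Xa ?Ya.
  by apply/subsetP => e; rewrite !inE ZE => /eqP ->.
have Xg : X g = SPos by rewrite XT.
have [X0|Xn0] := eqVneq (svneg X) set0.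
  have nX : nonneg X.
    by apply/nonnegP => e /eqP Xe; have := in_set0 e; rewrite -X0 inE Xe.
  have XA e : e \in A -> X e = SZero.
    move=> eA; have : e \in B by rewrite in_setD X0 in_set0.
    by rewrite BE => /andP[_ /eqP].
  apply: (@morse_cone _ a) => t.
  have memN s : (s \in nerve O Q A) = (s \subset A).
    apply/nerveP/idP => [[]//|sA]; split=> //; exists X => //; split=> //.
      exact: hQ.
    by apply/vanishesP => e /(subsetP sA)/XA.
  by rewrite !memN subUset sub1set aA.
have step : A :\: (B :\ a) = a |: svneg X.
  by rewrite setDDr AB setUC (setIidPr _) // sub1set.
apply: (@nerve_parallel _ _ _ (B :\ a) a) => //.
- by rewrite !inE eqxx.
- exact: subset_trans (subsetDl B [set a]) (subsetDl A _).
- by move=> b Y; rewrite in_setD1 => /andP[_]; apply: par.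
have aX : a \notin svneg X by rewrite inE Xa.
have lt : #|svneg X| < n.
  rewrite -En; apply: proper_card; apply/properP; split=> //.
  by exists a; rewrite ?aA.
rewrite step -[[::]]/([::] ++ [seq a |: t | t <- [::]]).
apply: nerve_split; first exact: setU11.
  rewrite setU1K //.
  have e : svneg (svcomp X T) = svneg X.
    apply/setP => e; rewrite !inE svcompE.
    by have := nT e; case: (X e); case: (T e).
  rewrite -e; apply: (IH _ lt O T) => //; rewrite ?e //.
  - by apply/nonnegP.
  - exact: covector_comp.
  - exact: subset_trans Xneg AT.
  - by rewrite svcompE Xg.
rewrite setU1K //.
have [Ta [TaO nTa Tamax]] := nonneg_top (contract1 O a).
have [sub|/subsetPn[z zX zT]] := boolP (svneg X \subset supp Ta).
  apply: (IH _ lt _ Ta) => //.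
    by rewrite in_contract1 XO Xa eqxx.
  by move=> Y; rewrite in_contract1 => /andP[YO _]; apply: hQ.
apply: (@nerve_cone _ _ _ z) => // Y YO nY _; apply/eqP; apply: contraT => Yz.
by have /subsetP/(_ z) := Tamax Y YO nY; rewrite (negPf zT) inE Yz => /(_ isT).
Qed.

End Nerve.

Section Spheres.
Variable E : finType.
Implicit Types (O : orientedMatroid E) (T X Y P : signvec E) (A B W : {set E}).

Definition nonzero_at (g : E) : pred (signvec E) := fun X => X g != SZero.

Definition nonzero : pred (signvec E) := fun X => X != svzero E.

Lemma nonneg_pos X e : nonneg X -> X e != SZero -> X e = SPos.
Proof. by move=> /nonnegP/(_ e); case: (X e). Qed.

(** The facets not parallel to the recession direction [P] are those visible
    from the point infinitely far away in direction [svopp P].  Each parallel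
    facet contributes its link, in which [P] still is a recession direction. *)
Lemma nerve_recession O P W g : P \in O -> nonneg P -> P g = SZero ->
    supp P != set0 -> supp P \subset W -> g \notin W ->
  morse [::] (nerve O (nonzero_at g) W).
Proof.
move En: #|W :\: supp P| => n; elim: n O W En => [|n IH] O W En PO nP Pg P0 PW gW.
  have WP : W = supp P.
    by apply/eqP; rewrite eqEsubset PW andbT -setD_eq0 -cards_eq0 En.
  have [T [TO nT Tmax]] := nonneg_top O.
  have [Tg|Tg] := eqVneq (T g) SZero.
    have /set0Pn[z zP] := P0.
    apply: (@nerve_cone _ _ _ _ z) => [|X XO nX Xg]; first by rewrite WP.
    by have /subsetP/(_ g) := Tmax X XO nX; rewrite !inE Tg eqxx => /(_ Xg).
  pose Th := svcomp (svopp P) T.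
  have ThE e : Th e = if sopp (P e) != SZero then sopp (P e) else T e.
    by rewrite svcompE svoppE.
  have eP : svneg Th = W.
    apply/setP => e; rewrite WP !inE ThE.
    by move/nonnegP/(_ e): nP; move/nonnegP/(_ e): nT; case: (P e); case: (T e).
  rewrite -eP; apply: (@nerve_visible _ _ _ T _ g) => //.
  - by rewrite covector_comp ?covector_opp.
  - by rewrite eP WP.
  - by rewrite eP WP; apply: Tmax.
  - by rewrite ThE Pg; apply: nonneg_pos.
  - by move=> X _ _; rewrite /nonzero_at => ->.
have /set0Pn[w wW] : W :\: supp P != set0 by rewrite -cards_eq0 En.
have := wW; rewrite !inE negbK => /andP[/eqP Pw w_W].
have Ww : P \in contract1 O w by rewrite in_contract1 PO Pw eqxx.
have PWw : supp P \subset W :\ w by rewrite subsetD1 PW inE Pw eqxx.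
have gWw : g \notin W :\ w by rewrite inE (negPf gW) andbF.
have Enw : #|(W :\ w) :\: supp P| = n.
  move: En; rewrite (cardsD1 w) wW add1n => -[<-].
  by rewrite setDDl setUC -setDDl.
rewrite -[[::]]/([::] ++ [seq w |: t | t <- [::]]).
by apply: nerve_split => //; apply: IH.
Qed.

(** The boundary of a cone of rank r is a sphere of dimension r - 2: take a
    facet, that is a face [P] of maximal support vanishing at some [e].  All
    other facets are visible from [svcomp (svopp P) T], the antipode of a point
    just beyond [P]; so they contribute no critical cell, and the facet [P]
    contributes its own boundary sphere.  The elements chosen
    form a basis [B]: it spans because [P] has maximal support, and it is
    independent because [T] is nonzero at [e] and the later faces vanish there. *)
Lemma nerve_sphere O T : T \in O -> nonneg T ->
    (forall X, X \in O -> supp X \subset supp T) -> supp T != set0 ->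
  exists c B, [/\ morse [:: c] (nerve O nonzero (supp T)),
    #|B| = #|c|.+1 /\ B \subset supp T,
    forall X, X \in O -> vanishes X B -> X = svzero E &
    forall X, X \in vectors O -> supp X \subset B -> X = svzero E].
Proof.
move En: #|supp T| => n; elim/ltn_ind: n O T En => n IH O T En TO nT Tmax T0.
have [e0 e0T] := set0Pn _ T0.
have Tpos e : e \in supp T -> T e = SPos by rewrite inE; apply: nonneg_pos.
pose face := [pred u : E * signvec E |
  [&& u.2 \in O, nonneg u.2, u.1 \in supp T & u.2 u.1 == SZero]].
have face0 : face (e0, svzero E).
  by rewrite /= covector0 ffunE eqxx e0T !andbT; apply/nonnegP => e; rewrite ffunE.
(* A facet, as a pair of a wall e and a face P of maximal support in it *)
case: (@arg_maxnP _ _ face (fun u => #|supp u.2|) face0).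
move=> [e P] /and4P[/= PO nP eT /eqP Pe] Pmax0.
have Pmax f Q : f \in supp T -> Q \in O -> nonneg Q -> Q f = SZero ->
    ~~ (supp P \proper supp Q).
  move=> fT QO nQ Qf; apply/negP => /proper_card; rewrite ltnNge => /negP[].
  by apply: (Pmax0 (f, Q)); rewrite /= QO nQ fT Qf eqxx.
have {Pmax0} Ppos f : f \in supp P -> P f = SPos by rewrite inE; apply: nonneg_pos.
have Toff f X : X \in O -> T f = SZero -> X f = SZero.
  move=> /Tmax/subsetP/(_ f); rewrite !inE => h Tf; apply/eqP.
  by apply: contraT => /h; rewrite Tf.
(* A covector through e that is nonzero outside the support of P leads, by
   repeated elimination against T, to a face with larger support than P *)
have flat X : X \in O -> X e = SZero -> supp X \subset supp P.
  move=> XO Xe; apply/subsetP => f fX; apply: contraT => fP.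
  have [X' X'O [X'f X'e]] : exists2 X', X' \in O & X' f = SNeg /\ X' e = SZero.
    move: fX; rewrite inE; case Xf: (X f) => // _; first by exists X.
    by exists (svopp X); rewrite ?covector_opp // !svoppE Xf Xe.
  pose S := [pred Z : signvec E | [&& Z \in O, [forall w in e |: supp P, Z w == SPos]
     & [exists w in supp T, Z w == SZero]]].
  have SI Z Y h : Z \in O -> T h = SPos -> Z h = SNeg ->
     (forall w, w \in e |: supp P -> T w = SPos /\ Z w <> SNeg) ->
     Y \in O -> Y h = SZero ->
     (forall w, T w = SZero \/ Z w = SZero \/ T w = Z w -> Y w = svcomp T Z w) ->
     Y \in S.
    move=> ZO Th Zh hZ YO Yh hY; apply/and3P; split=> //.
      apply/forall_inP => w /hZ[Tw Zw]; rewrite hY ?svcompE Tw //.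
      by case: (Z w) Zw; tauto.
    by apply/exists_inP; exists h; rewrite ?Yh // inE Th.
  have pT w : w \in e |: supp P -> T w = SPos.
    rewrite !inE => /orP[/eqP ->|wP]; first exact: Tpos.
    by apply: Tpos; move/subsetP: (Tmax P PO); apply; rewrite inE.
  have [Z0 Z0S] : exists Z, Z \in S.
    pose Y0 := svcomp P X'.
    have Y0O : Y0 \in O by apply: covector_comp.
    have Y0f : Y0 f = SNeg by move: fP; rewrite inE svcompE => /negPf ->.
    have Tf : T f = SPos by apply: Tpos; apply: (subsetP (Tmax X XO)).
    have [||Y YO [Yf hY]] := om_elim TO Y0O (v := f); rewrite ?Tf ?Y0f //.
    exists Y; apply: (SI Y0 Y f) => // w wP; split; first exact: pT.
    move: wP; rewrite in_setU1 svcompE => /orP[/eqP ->|wP].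
      by rewrite Pe /= X'e.
    by rewrite Ppos.
  case: (@arg_minnP _ Z0 [in S] (fun Z => #|svneg Z|) Z0S) => Z ZS Zmin.
  have /and3P[ZO /forall_inP Zpos /exists_inP[w wT /eqP Zw]] := ZS.
  have nZ : nonneg Z.
    apply/nonnegP => h Zh; have Th : T h = SPos.
      by apply: Tpos; apply: (subsetP (Tmax Z ZO)); rewrite inE Zh.
    have [||Y YO [Yh hY]] := om_elim TO ZO (v := h); rewrite ?Th ?Zh //.
    have YS : Y \in S.
      apply: (SI Z Y h) => // x xP; split; first exact: pT.
      by have /eqP -> := Zpos x xP.
    have := Zmin Y YS; rewrite /= leqNgt => /negP[]; apply: proper_card.
    apply/properP; split; last by exists h; rewrite inE ?Zh ?Yh.
    apply/subsetP => x; rewrite !inE => /eqP Yx; apply: contraT => Zx.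
    have Tx : T x = SZero \/ Z x = SZero \/ T x = Z x.
      case Ex : (T x) (nonnegP _ nT x) => // _; first by left.
      by case: (Z x) Zx => // _; tauto.
    have := hY x Tx; rewrite Yx svcompE; case: (T x =P SZero) => [Tx0|_ Tx'].
      by rewrite /= (Toff x Z ZO Tx0).
    by case: (nonnegP _ nT x (esym Tx')).
  have := Pmax w Z wT ZO nZ Zw; rewrite properE => /negP[]; apply/andP; split.
    apply/subsetP => x xP; rewrite inE.
    by have /eqP -> : Z x == SPos by apply: Zpos; rewrite inE xP orbT.
  apply/subsetPn; exists e; last by rewrite inE Pe.
  by rewrite inE; have /eqP -> : Z e == SPos by apply: Zpos; rewrite setU11.
have par f X : f \in supp T -> f \notin supp P -> X \in O -> nonneg X ->
    X f = SZero -> X e = SZero.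
  move=> fT fP XO nX Xf; apply/eqP; apply: contraT => Xe.
  have := Pmax f (svcomp P X) fT; rewrite covector_comp // nonneg_comp // svcompE.
  move: (fP); rewrite inE negbK => /eqP Pf; rewrite Pf /= => /(_ isT isT Xf) /negP[].
  rewrite properE; apply/andP; split.
    by apply/subsetP => x; rewrite !inE svcompE => h; rewrite h h.
  by apply/subsetPn; exists e; rewrite !inE ?svcompE Pe.
have PT : supp P \subset supp T by apply: Tmax.
have [P0|Pn0] := eqVneq (supp P) set0.
  exists set0, [set e]; rewrite cards0 cards1 sub1set; split=> //.
  - have -> : nerve O nonzero (supp T) = [set set0].
      apply/setP => t; rewrite in_set1; apply/nerveP/eqP => [[tT [X XO [nX X0 Xt]]]|->].
        apply/eqP; apply: contraT => /set0Pn[f ft]; move/eqP: X0 => [].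
        apply: supp_eq0 => x; have Xe : X e = SZero.
          apply: (par f) => //; first exact: (subsetP tT).
            by rewrite P0 inE.
          exact: (vanishesP _ _ Xt).
        apply/eqP; apply: contraT => Xx.
        by have /subsetP/(_ x) := flat X XO Xe; rewrite P0 !inE Xx => /(_ isT).
      split; first exact: sub0set.
      exists T => //; split=> //; last by apply/vanishesP => x; rewrite inE.
      by apply/eqP => z; move: e0T; rewrite inE z ffunE.
    exact: morse_cell.
  - move=> X XO /vanishesP/(_ e (set11 _)) Xe; apply: supp_eq0 => x.
    apply/eqP; apply: contraT => Xx.
    by have /subsetP/(_ x) := flat X XO Xe; rewrite P0 !inE Xx => /(_ isT).
  - move=> X /vectorsP/(_ T TO) o /subsetP Xs; apply: supp_eq0 => x.
    have Xx f : f != e -> X f = SZero.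
      by move=> fe; apply/eqP; apply: contraTT (fe) => nX; rewrite negbK -in_set1 Xs ?inE.
    case: (eqVneq x e) => [->|/Xx //].
    have [||//] := svorth_at (e := e) o; last by move: eT; rewrite inE => /eqP.
    by move=> f /Xx; right.
have ltP : #|supp P| < n.
  rewrite -En; apply: proper_card; apply/properP; split=> //.
  by exists e; rewrite // inE Pe.
have Pe_ : P \in contract1 O e by rewrite in_contract1 PO Pe eqxx.
have [|//|c [B [mB [cB BP] Bspan Bind]]] := IH _ ltP (contract1 O e) P erefl Pe_ nP.
  by move=> X; rewrite in_contract1 => /andP[XO /eqP]; apply: flat.
have eP : e \notin supp P by rewrite inE Pe.
have eB : e \notin B by apply: contra eP; apply: (subsetP BP).
have ec : e \notin c.
  have /nerveP[/subsetP cP _] := morse_cells mB (mem_head c [::]).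
  by apply: contra eP; apply: cP.
exists (e |: c), (e |: B); split.
- apply: (@nerve_parallel _ _ _ _ (supp T :\: (e |: supp P)) e) => //.
  + by rewrite !inE eqxx.
  + exact: subsetDl.
  + move=> b X; rewrite in_setD in_setU1 negb_or => /andP[/andP[_ bP] bT].
    exact: par.
  have -> : supp T :\: (supp T :\: (e |: supp P)) = e |: supp P.
    by rewrite setDDr setDv set0U (setIidPr _) // subUset sub1set eT.
  rewrite -[[:: _]]/([::] ++ [seq e |: t | t <- [:: c]]).
  apply: nerve_split; rewrite ?setU11 ?setU1K //.
  pose Th := svcomp (svopp P) T.
  have ThE f : Th f = if sopp (P f) != SZero then sopp (P f) else T f.
    by rewrite svcompE svoppE.
  have eTh : svneg Th = supp P.
    apply/setP => f; rewrite !inE ThE.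
    by move/nonnegP/(_ f): nP; move/nonnegP/(_ f): nT; case: (P f); case: (T f).
  rewrite -eTh; apply: (@nerve_visible _ _ _ T _ e) => //.
  + by move=> X XO _; apply: Tmax.
  + by rewrite covector_comp ?covector_opp.
  + by rewrite eTh.
  + by rewrite eTh.
  + by rewrite ThE Pe; apply: Tpos.
  + by move=> X _ _ Xe; apply/eqP => z; move: Xe; rewrite z ffunE.
- by rewrite !cardsU1 eB ec cB subUset sub1set eT (subset_trans BP).
- move=> X XO; rewrite vanishesU => /andP[Xe XB].
  by apply: Bspan; rewrite // in_contract1 XO.
move=> X XV XB.
have Xu : update X e SZero = svzero E.
  apply: Bind.
    apply/vectorsP => Y; rewrite in_contract1 => /andP[YO /eqP Ye].
    apply: svorth_ext (vectorsP _ _ XV Y YO) => f; rewrite ffunE.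
    by case: eqP => [->|_]; [left|right].
  apply/subsetP => f; rewrite inE ffunE; case: (eqVneq f e) => // fe Xf.
  by move/subsetP/(_ f): XB; rewrite !inE (negPf fe); apply.
have Xf f : f != e -> X f = SZero.
  by move=> /negPf fe; move/ffunP/(_ f): Xu; rewrite !ffunE fe.
apply: supp_eq0 => x; case: (eqVneq x e) => [->|/Xf //].
have [||//] := svorth_at (e := e) (vectorsP _ _ XV T TO).
  2: by move: eT; rewrite inE => /eqP.
by move=> f /Xf; right.
Qed.

End Spheres.

(** * Rank, independence and spanning *)

Section Rank.
Variable E : finType.
Implicit Types (O : orientedMatroid E) (X Y : signvec E) (D : {set E}).

Lemma svleP X Y : reflect (forall e, X e = SZero \/ X e = Y e) (@svle E X Y).
Proof.
apply: (iffP forallP) => h e; first by case/orP: (h e) => /eqP; tauto.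
by case: (h e) => ->; rewrite eqxx ?orbT.
Qed.

Lemma path_svle X t Y : path (@svlt E) X t -> Y \in X :: t -> svle Y (last X t).
Proof.
elim: t X Y => [|Z t IH] X Y /=.
  by rewrite inE => _ /eqP ->; apply/svleP; right.
case/andP=> /andP[_ XZ] pt; rewrite inE => /orP[/eqP ->|]; last exact: IH.
by apply: svle_trans XZ _; apply: IH; rewrite ?mem_head.
Qed.

(** Independence means that no vector is supported on [D], so by painting each
    element of [D] is separated from the rest by a covector.  Composing these
    covectors one after the other gives a chain of length [#|D|]. *)
Lemma rank_ge O D :
    (forall X, X \in vectors O -> supp X \subset D -> X = svzero E) ->
  #|D| <= om_rank O.
Proof.
move=> ind; have sep d : d \in D ->
    exists2 X, X \in O & vanishes X (D :\ d) /\ X d != SZero.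
  move=> dD; pose sigma : signvec E := [ffun f => if f == d then SPos else SZero].
  have sE f : sigma f = if f == d then SPos else SZero by rewrite ffunE.
  have [/exists_inP[X XO /and3P[XD /eqP Xd _]]|no] := boolP
    [exists X in O, [&& vanishes X (D :\ d), X d == sigma d & agrees sigma (supp sigma) X]].
    by exists X => //; split=> //; rewrite Xd sE eqxx.
  have [||X XV [Xd /agreesP Xa]] := painting _ _ no.
  - apply/pred0P => f; rewrite /= !inE sE.
    by case: (f == d); rewrite ?andbF.
  - by rewrite sE eqxx.
  suff X0 : X = svzero E by move: Xd; rewrite X0 sE eqxx ffunE.
  apply: ind => //; apply/subsetP => f; rewrite inE; apply: contraR => fD.
  have [|->|->] := Xa f; rewrite ?inE ?(negPf fD) ?andbF //.
  by rewrite sE; case: (eqVneq f d) fD => // ->; rewrite dD.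
suff [t [st pt tO _]] : exists t, [/\ size t = size (enum D),
    path (@svlt E) (svzero E) t, all [in O] t &
    vanishes (last (svzero E) t) (D :\: [set:: enum D])].
  rewrite /om_rank; case: ex_maxnP => i _; apply; apply/existsP.
  have st' : size t == #|D| by rewrite st -cardE.
  by exists (Tuple st'); rewrite pt.
have : {subset enum D <= D} by move=> f; rewrite mem_enum.
elim: (enum D) (enum_uniq D) => [|d s IH] /=.
  exists [::]; split=> //; apply/vanishesP => f; by rewrite ffunE.
case/andP => ds us sD.
have [|t [st pt tO /vanishesP tv]] := IH us.
  by move=> f fs; apply: sD; rewrite inE fs orbT.
have dD : d \in D by apply: sD; rewrite mem_head.
have [X XO [/vanishesP XD Xd]] := sep d dD.
set L := last (svzero E) t in tv.
have LO : L \in O.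
  by rewrite /L; case: (lastP t) tO => [|t' x]; rewrite ?covector0 // all_rcons last_rcons => /andP[].
have Ld : L d = SZero by apply: tv; rewrite !inE dD andbT.
exists (rcons t (svcomp L X)); split.
- by rewrite size_rcons st.
- rewrite rcons_path pt -/L /svlt /=; apply/andP; split.
    apply: contraNneq Xd => e; move: (congr1 (fun Z : signvec E => Z d) e).
    by rewrite /= svcompE Ld eqxx /= => <-.
  by apply/svleP => f; rewrite svcompE; case: (L f =P SZero); tauto.
- by rewrite all_rcons tO andbT; apply: covector_comp.
rewrite last_rcons; apply/vanishesP => f; rewrite !inE negb_or => /andP[/andP[fd fs] fD].
by rewrite svcompE tv ?inE ?fs //= XD // !inE fd.
Qed.

(** Exchange: let [e] be an element that the last but one member [L] of a
    chain misses and the last one [X] does not.  As [e] depends on [D], there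
    is a vector through [e] supported on [D] and [e]; replacing by [e] an
    element [d] of [D] on that vector, [D :\ d] spans the contraction of [e],
    which contains the rest of the chain. *)
Lemma rank_le O D :
  (forall X, X \in O -> vanishes X D -> X = svzero E) -> om_rank O <= #|D|.
Proof.
move=> span; rewrite /om_rank; case: ex_maxnP => k /existsP[t /andP[pt tO]] _.
rewrite -(size_tuple t).
elim/last_ind: {t k}(tval t) O D span pt tO => [//|t X IH] O D span.
rewrite rcons_path all_rcons size_rcons => /andP[pt /andP[nX /svleP LX]] /andP[XO tO].
set L := last _ _ in nX LX.
have [e Le Xe] : exists2 e, L e = SZero & X e <> SZero.
  case: (pickP (fun e => (L e == SZero) && (X e != SZero))) => [e /andP[]|no].
    by move=> /eqP Le /eqP Xe; exists e.
  case/eqP: nX; apply/ffunP => e; have := no e; have := LX e.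
  by case: (L e =P SZero) => [->|]; [rewrite /= => _ /negbFE/eqP ->|tauto].
have te : all [in contract1 O e] t.
  apply/allP => Y Yt; rewrite /= in_contract1 (allP tO Y Yt).
  have /svleP/(_ e) := @path_svle _ _ Y pt (mem_behead (s := _ :: _) Yt).
  by rewrite -/L Le => -[] ->.
have [d dD span'] : exists2 d, d \in D &
    forall Y, Y \in contract1 O e -> vanishes Y (D :\ d) -> Y = svzero E.
  have red d Y : d \in D -> Y \in contract1 O e -> vanishes Y (D :\ d) ->
      Y d = SZero -> Y = svzero E.
    move=> dD; rewrite in_contract1 => /andP[YO _] YD Yd; apply: span => //.
    by rewrite -(setD1K dD) vanishesU Yd eqxx.
  case: (boolP (e \in D)) => eD.
    exists e => // Y YO YD; apply: (red e) => //.
    by move: YO; rewrite in_contract1 => /andP[_ /eqP].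
  pose sigma : signvec E := [ffun f => if f == e then X e else SZero].
  have sE f : sigma f = if f == e then X e else SZero by rewrite ffunE.
  have [|||Z ZV [Ze /agreesP Za]] := @painting _ O sigma D e.
  - apply/pred0P => f; rewrite /= !inE sE.
    by case: (eqVneq f e) => [->|]; rewrite ?(negPf eD) ?andbF.
  - by rewrite sE eqxx; apply/eqP.
  - apply/exists_inP => -[Y YO /and3P[YD /eqP Ye _]].
    by move: Ye; rewrite (span Y) // sE eqxx ffunE => /esym/Xe.
  have ZeX : Z e <> SZero by rewrite Ze sE eqxx.
  have [d dD Zd] : exists2 d, d \in D & Z d <> SZero.
    case: (pickP (fun d => (d \in D) && (Z d != SZero))) => [d /andP[dD /eqP Zd]|no].
      by exists d.
    have [|/Xe []|/ZeX []] := svorth_at (e := e) (vectorsP _ _ ZV X XO).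
    move=> f fe; right; have := no f; rewrite /=; case: (boolP (f \in D)) => fD /=.
      by move/negbFE/eqP.
    by have [|->|->] := Za f; rewrite ?inE // sE (negPf fe).
  exists d => // Y YO YD; apply: (red d) => //.
  move: YO; rewrite in_contract1 => /andP[YO /eqP Ye].
  have [|//|/Zd []] := svorth_at (e := d) (vectorsP _ _ ZV Y YO).
  move=> f fd; case: (boolP (f \in D)) => fD.
    by left; apply: (vanishesP _ _ YD); rewrite !inE fd.
  case: (eqVneq f e) => [->|fe]; first by left.
  by right; have [|->|->] := Za f; rewrite ?inE // sE (negPf fe).
by rewrite (cardsD1 d) dD add1n ltnS; apply: (IH (contract1 O e)).
Qed.

End Rank.

(** * The Alexander dual of the element-avoiding complex *)

Section Avoiding.
Variables (V : finType) (O : orientedMatroid (option V)).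
Implicit Types (U W : {set V}) (X : signvec (option V)).

Lemma in_ground U u : (Some u \in ground U) = (u \in U).
Proof. by rewrite /ground mem_imset //; apply: Some_inj. Qed.

Lemma None_ground U : (None \in ground U) = false.
Proof. by apply/negP => /imsetP[]. Qed.

Lemma in_Dcap X U : reflect (X \in O /\ forall u, u \in U -> X (Some u) != SNeg)
  (X \in Dcap O SPos (ground U)).
Proof.
rewrite inE; apply: (iffP andP) => -[XO h]; split=> //.
  move=> u uU; move/bigcapP/(_ (Some u)): h; rewrite in_ground => /(_ uU).
  by rewrite inE XO; case: (X _).
apply/bigcapP => _ /imsetP[u uU ->]; rewrite inE XO /=.
by have := h u uU; case: (X _).
Qed.

Lemma in_Bcap X U : reflect (X \in O /\ forall u, u \in U -> X (Some u) = SPos)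
  (X \in Bcap O SPos (ground U)).
Proof.
rewrite inE; apply: (iffP andP) => -[XO h]; split=> //.
  move=> u uU; move/bigcapP/(_ (Some u)): h; rewrite in_ground => /(_ uU).
  by rewrite inE XO => /eqP.
by apply/bigcapP => _ /imsetP[u uU ->]; rewrite inE XO /= h.
Qed.

Lemma avoidingN U : reflect
  (exists2 X, X \in vectors O & X None = SNeg /\
     forall u, X (Some u) <> SNeg /\ (X (Some u) = SPos -> u \in U))
  (U \notin avoiding_faces O).
Proof.
rewrite inE negbK !inE None_ground /=.
apply: (iffP exists_inP) => -[X XV].
  case/andP => /subsetP pX /eqP nX; exists X => //; split.
    by apply/eqP; have := set11 (None : option V); rewrite -nX inE.
  move=> u; split=> [/eqP|/eqP].
    have : (Some u \in svneg X) = false by rewrite nX inE.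
    by rewrite inE => ->.
  by rewrite -in_ground => Xu; apply: pX; rewrite inE.
case=> XN Xu; exists X => //; apply/andP; split.
  apply/subsetP => -[u|]; rewrite inE ?XN // in_ground => /eqP.
  by have [_] := Xu u.
apply/eqP/setP => -[u|]; rewrite !inE ?XN //=.
by have [+ _] := Xu u; case: (X _).
Qed.

(** Farkas' lemma, applied to the pattern that is minus at the base element and
    plus on [U]. *)
Lemma avoidingP U : reflect
  (exists2 X, X \in O & X None = SNeg /\ forall u, u \in U -> X (Some u) != SNeg)
  (U \in avoiding_faces O).
Proof.
apply: (iffP idP) => [UC|[X XO [XN Xu]]]; last first.
  apply/negPn/negP => /avoidingN[Y /vectorsP/(_ X XO) o [YN Yu]].
  have [||] := svorth_agree None o; rewrite ?XN ?YN //.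
  move=> [u|]; last by rewrite XN YN; tauto.
  have [Y1 Y2] := Yu u; case EY: (Y (Some u)) Y1 Y2 => // _; first by tauto.
  by move=> /(_ erefl)/Xu; case: (X _) => //; tauto.
pose sigma : signvec (option V) :=
  [ffun e => if e is Some u then if u \in U then SPos else SZero else SNeg].
have sE e : sigma e = if e is Some u then if u \in U then SPos else SZero else SNeg.
  by rewrite ffunE.
have [/exists_inP[X XO /andP[/eqP XN /agreesP Xa]]|no] := boolP
    [exists X in O, (X None == sigma None) && agrees sigma (supp sigma) X].
  exists X => //; split; first by rewrite XN sE.
  by move=> u uU; have [|->|->] := Xa (Some u); rewrite ?inE ?sE ?uU.
have [|Y YV [YN /agreesP Ya]] := painting0 _ no; first by rewrite sE.
move: UC; rewrite -[_ \in _]negbK => /negP[]; apply/avoidingN.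
exists Y => //; rewrite YN sE; split=> // u.
by have [|->|->] := Ya (Some u); rewrite ?sE ?inE //; case: ifP.
Qed.

Lemma avoiding_DB U : (U \in avoiding_faces O) =
  (Dcap O SPos (ground U) :&: Bset O SNeg None != set0).
Proof.
apply/avoidingP/set0Pn => [[X XO [XN Xu]]|[X]].
  exists X; apply/setIP; split; first exact/in_Dcap.
  by rewrite inE XO XN.
case/setIP => /in_Dcap[XO Xu]; rewrite inE => /andP[_ /eqP XN].
by exists X.
Qed.

Definition ground0 W : {set option V} := None |: ground W.

(** The vectors supported on [W] and the base element, with the sign of the
    base element reversed: a vector witnessing that a subset of [W] is a
    non-face becomes a nonnegative covector of this oriented matroid. *)
Definition dual_minor W : orientedMatroid (option V) :=
  contract (reorient (dual O) [set None]) (~: ground0 W).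

Lemma in_dual_minor W X : reflect
  (flip [set None] X \in vectors O /\ forall e, e \notin ground0 W -> X e = SZero)
  (X \in dual_minor W).
Proof.
rewrite in_contract in_reorient; apply: (iffP andP) => -[h1 h2]; split=> //.
  by move=> e eW; apply: (vanishesP _ _ h2); rewrite inE.
by apply/vanishesP => e; rewrite inE; apply: h2.
Qed.

Definition nonfaces W : {set {set V}} :=
  [set U : {set V} | (U \subset W) && (U \notin avoiding_faces O)].

Lemma flipN X u : flip [set None] X (Some u) = X (Some u).
Proof. by rewrite flipE inE. Qed.

Lemma flipN0 X : flip [set None] X None = sopp (X None).
Proof. by rewrite flipE inE. Qed.

Lemma nonfaces_nerve W : nonfaces W =
  [set cocell Some W t | t in nerve (dual_minor W) (nonzero_at None) (ground W)].
Proof.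
apply/setP => U; rewrite inE; apply/andP/imsetP.
  case=> UW /avoidingN[X XV [XN Xu]].
  exists (ground (W :\: U)); last first.
    apply/setP => u; rewrite !inE in_ground inE.
    by case: (boolP (u \in U)) => [/(subsetP UW) ->|]; rewrite ?andbT ?andNb.
  apply/nerveP; split; first by apply: imsetS; apply: subsetDl.
  exists (flip [set None] X).
    apply/in_dual_minor; rewrite flipK; split=> // -[u|]; rewrite !inE //.
    rewrite /= in_ground flipN => uW; have [] := Xu u; case: (X (Some u)) => // _ h.
    by move: uW; rewrite (subsetP UW) ?h.
  split.
  - apply/nonnegP => -[u|]; rewrite ?flipN ?flipN0 ?XN //.
    by have [] := Xu u.
  - by rewrite /nonzero_at flipN0 XN.
  apply/vanishesP => _ /imsetP[u + ->]; rewrite inE flipN => /andP[uU _].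
  have [] := Xu u; case: (X (Some u)) => // _ h.
  by move: uU; rewrite h.
case=> t /nerveP[tW [X /in_dual_minor[XV XW] [nX XN /vanishesP Xt]]] ->.
split; first exact: subsetDl.
apply/avoidingN; exists (flip [set None] X) => //; split.
  by rewrite flipN0 (nonneg_pos nX).
move=> u; rewrite flipN; split; first exact: (nonnegP _ nX).
move=> Xu; rewrite !inE; apply/andP; split.
  by apply/negP => /Xt; rewrite Xu.
by apply: contraT => uW; have := XW (Some u); rewrite !inE /= in_ground Xu uW => /(_ isT).
Qed.

(** The positive cone of the dual has an interior point that is strictly
    positive on [W] and at the base element, and does not meet the hyperplane
    at infinity given by the base element: its affine slice is a polytope. *)
Definition bounded W : bool :=
  [exists T in dual_minor W, nonneg T && (ground0 W \subset supp T)] &&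
  [forall X in dual_minor W, nonneg X ==> (X None == SZero) ==> (X == svzero _)].

Lemma dual_minor_supp W X : X \in dual_minor W -> supp X \subset ground0 W.
Proof.
case/in_dual_minor => _ h; apply/subsetP => e; rewrite inE.
by apply: contraR => /h ->.
Qed.

Lemma nonfaces_sub W t : t \in nerve (dual_minor W) (nonzero_at None) (ground W) ->
  t \subset Some @: W.
Proof. by case/nerveP. Qed.

(** Either there is a recession direction, or the largest face [T] vanishes at
    some [e].  If [e] is the base element the nerve is void; otherwise all
    faces lie on [e] and the nerve is a cone. *)
Lemma nonfaces_unbounded W : W != set0 -> ~~ bounded W -> morse [::] (nonfaces W).
Proof.
move=> W0 nb; rewrite nonfaces_nerve -[[::]]/(rev [seq cocell Some W t | t <- [::]]).
apply: morse_cocell; [exact: Some_inj|exact: nonfaces_sub|].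
have [w wW] := set0Pn _ W0.
have wg : Some w \in ground W by rewrite in_ground.
have [T [TO nT Tmax]] := nonneg_top (dual_minor W).
case: (boolP (ground0 W \subset supp T)) => [WT|/subsetPn[e eW eT]].
  move: nb; rewrite negb_and => /orP[/exists_inP[]|].
    by exists T; rewrite // nT.
  case/forall_inPn => X XM; rewrite !negb_imply => /and3P[nX /eqP XN X0].
  apply: (nerve_recession XM) => //; last by rewrite None_ground.
    apply: contraNneq X0 => X0; apply/eqP/supp_eq0 => e; apply/eqP.
    by apply: contraT => Xe; have := in_set0 e; rewrite -X0 inE Xe.
  apply/subsetP => e eX; have := subsetP (dual_minor_supp XM) e eX.
  by rewrite !inE => /orP[/eqP eN|//]; move: eX; rewrite eN inE XN.
have X0 X : X \in dual_minor W -> nonneg X -> X e = SZero.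
  move=> XM nX; apply/eqP; apply: contraT => Xe.
  by have := subsetP (Tmax X XM nX) e; rewrite inE (negPf eT) => /(_ Xe).
move: eW; rewrite in_setU1 => /orP[/eqP eN|eW].
  apply: (nerve_cone wg) => X XM nX; rewrite /nonzero_at -eN.
  by rewrite X0 // eqxx.
by apply: (nerve_cone eW) => X XM nX _; apply: X0.
Qed.

Lemma card_ground U : #|ground U| = #|U|.
Proof. by rewrite card_imset //; apply: Some_inj. Qed.

(** The set [D] is the complement of the basis of the dual found in
    [nerve_sphere]; a basis of the dual is the complement of a basis. *)
Lemma nonfaces_bounded W : bounded W ->
  exists (c : {set V}) (D : {set option V}),
  [/\ morse [:: c] (nonfaces W), #|D| = #|c| & D \subset ground0 W] /\
  [/\ forall X, X \in vectors O -> supp X \subset D -> X = svzero _ &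
    forall X, X \in O -> vanishes X D -> forall e, e \in ground0 W -> X e = SZero].
Proof.
case/andP => /exists_inP[T TM /andP[nT WT]] /forall_inP rec.
have {}rec X : X \in dual_minor W -> nonneg X -> X None = SZero -> X = svzero _.
  by move=> /rec/implyP h /h /implyP{}h /eqP/h/eqP.
have sT : supp T = ground0 W.
  by apply/eqP; rewrite eqEsubset dual_minor_supp.
have [||||c [B [mc [cB BW] Bspan Bind]]] := @nerve_sphere _ (dual_minor W) T => //.
- by move=> X XM; rewrite sT; apply: dual_minor_supp.
- by apply/set0Pn; exists None; rewrite sT setU11.
have eN : nerve (dual_minor W) (@nonzero _) (supp T) =
          nerve (dual_minor W) (nonzero_at None) (ground W).
  apply/setP => t; apply/nerveP/nerveP => -[tW [X XM [nX QX Xt]]]; split.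
  - move: tW; rewrite sT => /subsetP tW; apply/subsetP => e et.
    have := tW e et; rewrite in_setU1 => /orP[/eqP eN|//].
    case/eqP: QX; apply: rec => //; rewrite -eN; exact: (vanishesP _ _ Xt).
  - exists X => //; split=> //; apply: contraNneq QX => XN; apply/eqP.
    exact: rec.
  - by rewrite sT; apply: subset_trans tW _; apply: subsetUr.
  exists X => //; split=> //; apply: contraNneq QX => ->.
  by rewrite /nonzero_at ffunE.
have cW : c \subset ground W.
  by have := morse_cells mc (mem_head _ _); rewrite eN => /nerveP[].
exists (cocell Some W c), (ground0 W :\: B); split; split.
- rewrite nonfaces_nerve -[[:: _]]/(rev [seq cocell Some W t | t <- [:: c]]).
  apply: morse_cocell; [exact: Some_inj|exact: nonfaces_sub|by rewrite -eN].
- rewrite cardsD -sT (setIidPr BW) sT cB /cocell cardsD.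
  rewrite cardsU1 None_ground card_ground add1n subSS; congr (_ - _)%N.
  rewrite -card_ground; congr #|pred_of_set _|; apply/setP => e.
  apply/idP/imsetP => [ec|[u + ->]]; last by rewrite !inE => /andP[].
  have /imsetP[u uW eu] := subsetP cW e ec.
  by exists u; rewrite // !inE uW -eu.
- exact: subsetDl.
- move=> X XV XD.
  suff: flip [set None] X = svzero _.
    move=> z; rewrite -[X](flipK [set None]) z; apply/ffunP => e.
    by rewrite flipE ffunE; case: ifP.
  have fe e : (flip [set None] X e == SZero) = (X e == SZero).
    by rewrite flipE; case: ifP; rewrite ?sopp_eq0.
  have Xout e : e \notin ground0 W :\: B -> X e = SZero.
    move=> eD; apply/eqP; apply: contraNT eD => Xe; apply: (subsetP XD).
    by rewrite inE.
  apply: Bspan.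
    apply/in_dual_minor; rewrite flipK; split=> // e eW; apply/eqP.
    by rewrite fe Xout // inE (negPf eW) andbF.
  apply/vanishesP => e eB; apply/eqP; rewrite fe Xout //.
  by rewrite inE eB.
move=> X XO XD e eW.
pose X' : signvec (option V) :=
  [ffun f => if f \in ground0 W then flip [set None] X f else SZero].
have X'E f : X' f = if f \in ground0 W then flip [set None] X f else SZero.
  by rewrite ffunE.
have X'0 : X' = svzero _.
  apply: Bind; last first.
    apply/subsetP => f; rewrite inE X'E; case: ifP => // fW.
    apply: contraR => fB.
    have Xf : X f = SZero by apply: (vanishesP _ _ XD); rewrite inE fB.
    by rewrite flipE Xf; case: ifP.
  apply/vectorsP => Y /in_dual_minor[YV YW].
  apply: (@svorth_ext _ Y (flip [set None] X)) => [f|].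
    by rewrite X'E; case: ifP => [_|/negbT fW]; [right|left; apply: YW].
  rewrite -[Y](flipK [set None]); apply: svorth_flip.
  exact/svorth_sym/(vectorsP _ _ YV).
move/ffunP/(_ e): X'0; rewrite X'E eW flipE ffunE; case: ifP => // _ /eqP.
by rewrite sopp_eq0 => /eqP.
Qed.

End Avoiding.

(** * Relative homology of convex families of sets *)

Local Open Scope ring_scope.

Section Families.
Variables (F : fieldType) (V : finType).
Local Notation chain := (chain_space F V).
Implicit Types (x y z w : chain) (s t : {set V}) (A B Y S : {set {set V}}).
Implicit Types (n : nat) (l : F).

Definition supported S x : Prop := forall t, t \notin S -> x t = 0.

(** Levels count elements of sets, so level [n] is degree [n - 1]. *)
Definition level Y n : {set {set V}} := [set t in Y | #|t| == n].

Definition restr S x : chain := [ffun t => if t \in S then x t else 0].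

(** For a convex family the boundary followed by restriction to the family
    squares to zero.  This is the relative chain complex of a pair of
    simplicial complexes, without reference to the pair. *)
Definition convex Y : Prop :=
  forall s t u : {set V}, s \in Y -> u \in Y -> s \subset t -> t \subset u -> t \in Y.

Lemma restrE S x t : restr S x t = if t \in S then x t else 0.
Proof. by rewrite ffunE. Qed.

Lemma chainD x y t : (x + y) t = x t + y t. Proof. by rewrite ffunE. Qed.
Lemma chainB x y t : (x - y) t = x t - y t. Proof. by rewrite !ffunE. Qed.
Lemma chainZ l x t : (l *: x) t = l * x t. Proof. by rewrite ffunE. Qed.

Lemma bdD x y t : boundary (x + y) t = boundary x t + boundary y t.
Proof. by rewrite linearD chainD. Qed.
Lemma bdB x y t : boundary (x - y) t = boundary x t - boundary y t.
Proof. by rewrite linearB chainB. Qed.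
Lemma bdZ l x t : boundary (l *: x) t = l * boundary x t.
Proof. by rewrite linearZ chainZ. Qed.

Lemma bd_face x t : boundary x t != 0 ->
  exists s v, [/\ x s != 0, v \in s & t = s :\ v].
Proof.
rewrite /boundary sum_ffunE => h.
have /existsP[s] : [exists s, (x s *: simplex_boundary F s) t != 0].
  apply: contraNT h => /existsPn h; rewrite big1 // => s _.
  by apply/eqP/negbNE; apply: h.
rewrite chainZ mulf_eq0 negb_or => /andP[xs]; rewrite /simplex_boundary sum_ffunE => {}h.
have /existsP[v /andP[vs]] : [exists v, (v \in s) &&
    (((-1) ^+ vpos s v *: simplex F (s :\ v)) t != 0)].
  apply: contraNT h => /existsPn h; rewrite big1 // => v vs.
  by apply/eqP; have := h v; rewrite vs /= => /negbNE.
rewrite chainZ ffunE; case: (t =P s :\ v) => [->|_]; last by rewrite mulr0 eqxx.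
by exists s, v.
Qed.

Lemma bd_eq0 x t :
  (forall s, t \subset s -> #|s| = #|t|.+1 -> x s = 0) -> boundary x t = 0.
Proof.
move=> h; apply/eqP; apply: contraT => /bd_face[s [v [xs vs et]]].
by rewrite h ?eqxx // et ?subsetDl // (cardsD1 v) vs in xs *.
Qed.

Lemma supported_level_sub S n x : supported (level S n) x -> supported S x.
Proof. by move=> h t tS; apply: h; rewrite inE (negPf tS). Qed.

(** What the restriction removes lives on faces of members of [Y] outside [Y];
    by convexity these have no face in [Y], so the removed part does not
    contribute to the second boundary. *)
Lemma bd_restr_restr Y x t : convex Y -> supported Y x -> t \in Y ->
  boundary (restr Y (boundary x)) t = 0.
Proof.
move=> cY xY tY; pose r := boundary x - restr Y (boundary x).
have -> : restr Y (boundary x) = boundary x - r by rewrite /r opprB addrC subrK.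
rewrite bdB boundary_boundary ffunE sub0r; apply/eqP; rewrite oppr_eq0; apply/eqP.
apply: bd_eq0 => s ts _; rewrite chainB restrE; case: ifP => [|sY]; first by rewrite subrr.
rewrite subr0; apply/eqP; apply: contraT => /bd_face[u [v [xu _ es]]].
have uY : u \in Y by apply: contraT => /xY e; rewrite e eqxx in xu.
by move/negP: sY; case; apply: (cY t s u) => //; rewrite es subsetDl.
Qed.

Lemma restr_bd_level Y n x : supported (level Y n.+1) x ->
  supported (level Y n) (restr Y (boundary x)).
Proof.
move=> xY t; rewrite inE restrE; case: ifP => //= tY tn.
apply: bd_eq0 => s _ ets; apply: xY; by rewrite inE ets eqSS (negPf tn) andbF.
Qed.

Lemma supportedD S x y : supported S x -> supported S y -> supported S (x + y).
Proof. by move=> hx hy t tS; rewrite chainD hx // hy // addr0. Qed.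

Lemma supportedB S x y : supported S x -> supported S y -> supported S (x - y).
Proof. by move=> hx hy t tS; rewrite chainB hx // hy // subr0. Qed.

Lemma supportedZ S l x : supported S x -> supported S (l *: x).
Proof. by move=> hx t tS; rewrite chainZ hx // mulr0. Qed.

Lemma supportedS S S' x : S \subset S' -> supported S x -> supported S' x.
Proof. by move=> /subsetP h hx t tS; apply: hx; apply: contra tS; apply: h. Qed.

Lemma levelS Y Y' n : Y \subset Y' -> level Y n \subset level Y' n.
Proof.
by move=> /subsetP h; apply/subsetP => t; rewrite !inE => /andP[/h ->].
Qed.

Definition cycle_in Y n x : Prop :=
  supported (level Y n) x /\ forall t, t \in Y -> boundary x t = 0.

Definition bounds Y n y x : Prop :=
  supported (level Y n.+1) y /\ forall t, t \in Y -> boundary y t = x t.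

Definition acyclic_at Y n : Prop :=
  forall x, cycle_in Y n x -> exists y, bounds Y n y x.

Definition generator Y n z : Prop :=
  [/\ cycle_in Y n z,
      forall l y, bounds Y n y (l *: z) -> l = 0 &
      forall x, cycle_in Y n x -> exists l y, bounds Y n y (x - l *: z)].

Lemma cycleB Y n x y : cycle_in Y n x -> cycle_in Y n y -> cycle_in Y n (x - y).
Proof.
move=> [x1 x2] [y1 y2]; split; first exact: supportedB.
by move=> t tY; rewrite bdB x2 ?y2 ?subrr.
Qed.

Lemma cycleZ Y n l x : cycle_in Y n x -> cycle_in Y n (l *: x).
Proof.
move=> [x1 x2]; split; first exact: supportedZ.
by move=> t tY; rewrite bdZ x2 ?mulr0.
Qed.

Lemma cycle_bd Y n y : convex Y -> supported (level Y n.+1) y ->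
  cycle_in Y n (restr Y (boundary y)).
Proof.
move=> cY hy; split; first exact: restr_bd_level.
by move=> t; apply: bd_restr_restr => //; apply: supported_level_sub hy.
Qed.

Section Layers.
Variables (A B : {set {set V}}).
Hypotheses (lAB : layered A B) (cY : convex (A :|: B)).
Local Notation Y := (A :|: B).

Let AY : A \subset Y. Proof. exact: subsetUl. Qed.
Let BY : B \subset Y. Proof. exact: subsetUr. Qed.

Let notAB t : t \in B -> t \notin A.
Proof. by move=> tB; apply/negP => tA; have := lAB tA tB; rewrite subxx. Qed.

Lemma convex_lower : convex A.
Proof.
move=> s t u sA uA st tu; have := cY (subsetP AY s sA) (subsetP AY u uA) st tu.
by rewrite inE => /orP[//|/(lAB uA)]; rewrite tu.
Qed.

Lemma convex_upper : convex B.
Proof.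
move=> s t u sB uB st tu; have := cY (subsetP BY s sB) (subsetP BY u uB) st tu.
by rewrite inE => /orP[|//] tA; have := lAB tA sB; rewrite st.
Qed.

Let bd_lower x t : supported A x -> t \in B -> boundary x t = 0.
Proof.
move=> xA tB; apply: bd_eq0 => s ts _; apply: xA.
by apply: contraL ts => sA; apply: lAB.
Qed.

Let bd_upper x t : supported Y x -> t \in B -> boundary (restr B x) t = boundary x t.
Proof.
move=> xY tB; apply/eqP; rewrite -subr_eq0 -bdB; apply/eqP/bd_lower => //.
move=> s sA; rewrite chainB restrE; case: ifP => sB; first by rewrite subrr.
by rewrite xY ?subr0 // inE (negPf sA) sB.
Qed.

Let restr_upper n x : supported (level Y n) x -> supported (level B n) (restr B x).
Proof.
move=> xY t; rewrite inE restrE; case: ifP => //= tB tn.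
by apply: xY; rewrite inE (negPf tn) andbF.
Qed.

Let supp_lower n x : supported (level Y n) x -> (forall t, t \in B -> x t = 0) ->
  supported (level A n) x.
Proof.
move=> xY xB t tA; case: (boolP (t \in B)) => [/xB //|tB].
by apply: xY; move: tA; rewrite !inE (negPf tB) orbF.
Qed.

Let level_sub S n x : supported (level S n) x -> supported S x.
Proof. exact: supported_level_sub. Qed.

Let upper_cycle n x : cycle_in Y n x -> cycle_in B n (restr B x).
Proof.
move=> [x1 x2]; split; first exact: restr_upper.
move=> t tB; rewrite bd_upper ?x2 //; last exact: level_sub x1.
exact: (subsetP BY).
Qed.

Let lower_cycle n x : cycle_in A n x <-> supported (level A n) x /\ cycle_in Y n x.
Proof.
split=> [[x1 x2]|[x1 [_ x2]]]; split=> //.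
  split; first exact: supportedS (levelS n AY) x1.
  move=> t; rewrite inE => /orP[/x2 //|]; apply: bd_lower; exact: level_sub x1.
by move=> t tA; apply: x2; apply: (subsetP AY).
Qed.

Let lower_bounds n y x : bounds A n y x -> supported A x -> bounds Y n y x.
Proof.
move=> [y1 y2] xA; split; first exact: supportedS (levelS _ AY) y1.
move=> t; rewrite inE; case: (boolP (t \in A)) => [/y2 //|tA /= tB].
by rewrite xA // bd_lower //; apply: level_sub y1.
Qed.

Let upper_bounds n y x : bounds Y n y x -> bounds B n (restr B y) (restr B x).
Proof.
move=> [y1 y2]; split; first exact: restr_upper.
move=> t tB; rewrite bd_upper //; last exact: level_sub y1.
by rewrite restrE tB y2 // inE tB orbT.
Qed.

(** The long exact sequence of the pair is used in the form of corrections of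
    chains: subtracting the boundary of a chain that bounds the [B]-part of a
    cycle pushes the cycle down to [A]. *)
Let push n x y : cycle_in Y n x -> bounds B n y (restr B x) ->
  cycle_in A n (x - restr Y (boundary y)).
Proof.
move=> cx [y1 y2]; have y1Y := supportedS (levelS n.+1 BY) y1.
have cz : cycle_in Y n (x - restr Y (boundary y)).
  by apply: cycleB => //; apply: cycle_bd.
apply/lower_cycle; split=> //; apply: supp_lower; first by case: cz.
by move=> t tB; rewrite chainB restrE inE tB orbT y2 // restrE tB subrr.
Qed.

Let bounds_push n x y w : supported (level B n.+1) y ->
  bounds Y n w (x - restr Y (boundary y)) -> bounds Y n (w + y) x.
Proof.
move=> y1 [w1 w2]; split.
  by apply: supportedD => //; apply: supportedS (levelS _ BY) y1.
by move=> t tY; rewrite bdD w2 // chainB restrE tY subrK.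
Qed.

(** With [acyclic_lower] and [acyclic_upper], exactness of the sequence of the
    pair at its three places. *)
Lemma acyclic_union n : acyclic_at A n -> acyclic_at B n -> acyclic_at Y n.
Proof.
move=> aA aB x cx; have [y hy] := aB _ (upper_cycle cx).
have cz := push cx hy; have [w hw] := aA _ cz.
exists (w + y); apply: bounds_push; first by case: hy.
by apply: lower_bounds => //; case: cz => /level_sub.
Qed.

Let correct n y x : supported A x -> bounds Y n y x -> acyclic_at B n.+1 ->
  exists y', bounds A n y' x.
Proof.
move=> xA [y1 y2] aB.
have [|z [z1 z2]] := aB (restr B y).
  split; first exact: restr_upper.
  move=> t tB; rewrite bd_upper //; last exact: level_sub y1.
  by rewrite y2 ?xA ?notAB // inE tB orbT.
have z1Y := supportedS (levelS _ BY) z1.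
have [r1 r2] := cycle_bd cY z1Y.
exists (y - restr Y (boundary z)); split.
  apply: supp_lower; first exact: supportedB.
  by move=> t tB; rewrite chainB restrE inE tB orbT z2 // restrE tB subrr.
by move=> t tA; rewrite bdB r2 ?subr0 ?y2 // inE tA.
Qed.

Lemma acyclic_lower n : acyclic_at Y n -> acyclic_at B n.+1 -> acyclic_at A n.
Proof.
move=> aY aB x /lower_cycle[x1 cx]; have [y hy] := aY x cx.
by apply: (correct _ hy) => //; apply: level_sub x1.
Qed.

Let connect n x : cycle_in B n.+1 x -> cycle_in A n (restr Y (boundary x)).
Proof.
move=> [x1 x2]; have x1Y := supportedS (levelS _ BY) x1.
have cr := cycle_bd cY x1Y; apply/lower_cycle; split=> //.
apply: supp_lower; first by case: cr.
by move=> t tB; rewrite restrE inE tB orbT x2.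
Qed.

Let lift n x w : cycle_in B n.+1 x -> bounds A n w (restr Y (boundary x)) ->
  cycle_in Y n.+1 (x - w).
Proof.
move=> cx [w1 w2]; have [x1 x2] := cx; split.
  by apply: supportedB; [apply: supportedS x1|apply: supportedS w1]; apply: levelS.
move=> t tY; rewrite bdB; move: (tY); rewrite inE; case: (boolP (t \in A)) => [tA _|tA /= tB].
  by rewrite w2 // restrE tY subrr.
by rewrite x2 // bd_lower ?subrr //; apply: level_sub w1.
Qed.

Let restr_lift n x w : supported (level B n) x -> supported (level A n) w ->
  restr B (x - w) = x.
Proof.
move=> x1 w1; apply/ffunP => t; rewrite restrE; case: ifP => tB.
  by rewrite chainB (level_sub w1) ?subr0 // notAB.
by rewrite (level_sub x1) ?tB.
Qed.

Lemma acyclic_upper n : acyclic_at A n -> acyclic_at Y n.+1 -> acyclic_at B n.+1.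
Proof.
move=> aA aY x cx; have [w hw] := aA _ (connect cx).
have [y hy] := aY _ (lift cx hw); exists (restr B y).
by have := upper_bounds hy; rewrite (restr_lift (n := n.+1)) //; [case: cx|case: hw].
Qed.

Lemma generator_lower n z : generator A n z ->
  acyclic_at B n -> acyclic_at B n.+1 -> generator Y n z.
Proof.
move=> [cz nz gz] aB aB'; have zA : supported A z by case: cz => /level_sub.
split.
- by have /lower_cycle[] := cz.
- move=> l y hy; have [|y' hy'] := correct _ hy aB'; first exact: supportedZ.
  exact: nz hy'.
move=> x cx; have [y hy] := aB _ (upper_cycle cx).
have cx' := push cx hy; have [l [w hw]] := gz _ cx'.
exists l, (w + y); apply: bounds_push; first by case: hy.
rewrite addrAC; apply: lower_bounds => //; apply: supportedB; last exact: supportedZ.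
by case: cx' => /level_sub.
Qed.

Lemma generator_upper n z : (forall m, acyclic_at A m) -> generator B n z ->
  exists z', generator Y n z'.
Proof.
move=> aA [cz nz gz].
have [w w1 cw] : exists2 w, supported (level A n) w & cycle_in Y n (z - w).
  case: n cz {nz gz} => [|n] cz.
    exists 0; first by move=> t _; rewrite ffunE.
    have [z1 z2] := cz; split.
      by rewrite subr0; apply: supportedS (levelS _ BY) z1.
    move=> t tY; rewrite subr0; apply: bd_eq0 => s ts es; apply: z1.
    by rewrite inE es andbF.
  have [w hw] := aA _ _ (connect cz); exists w; last exact: lift hw.
  by case: hw.
have rz : restr B (z - w) = z by apply: restr_lift w1; case: cz.
exists (z - w); split=> //.
  move=> l y /upper_bounds; have -> : restr B (l *: (z - w)) = l *: z.
    apply/ffunP => t; rewrite -[in RHS]rz restrE !chainZ restrE.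
    by case: ifP; rewrite ?mulr0.
  exact: nz.
move=> x cx; have [l [y hy]] := gz _ (upper_cycle cx).
have cx' : cycle_in Y n (x - l *: (z - w)) by apply: cycleB => //; apply: cycleZ.
have hy' : bounds B n y (restr B (x - l *: (z - w))).
  have -> // : restr B (x - l *: (z - w)) = restr B x - l *: z.
  apply/ffunP => t; rewrite -[in RHS]rz restrE !chainB !chainZ !restrE chainB.
  by case: ifP; rewrite ?mulr0 ?subr0.
have cx2 := push cx' hy'; have [u hu] := aA _ _ cx2.
exists l, (u + y); apply: bounds_push; first by case: hy'.
by apply: lower_bounds => //; case: cx2 => /level_sub.
Qed.

(** The connecting homomorphism carries a generator to a generator if the
    union has no homology on either side of it. *)
Lemma generator_connect n z : acyclic_at Y n -> acyclic_at Y n.+1 ->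
  generator B n.+1 z -> generator A n (restr Y (boundary z)).
Proof.
move=> aY aY' [cz nz gz]; have [z1 z2] := cz.
have z1Y := supportedS (levelS _ BY) z1.
split; first exact: connect.
  move=> l y [y1 y2]; have y1Y := supportedS (levelS _ AY) y1.
  have cy : cycle_in Y n.+1 (l *: z - y).
    apply: lift; first exact: cycleZ.
    split=> // t tA; rewrite y2 // chainZ !restrE inE tA bdZ //.
  have [u /upper_bounds hu] := aY' _ cy.
  apply: (nz l (restr B u)); rewrite -(restr_lift (n := n.+1) (supportedZ l z1) y1) //.
move=> x cx; have /lower_cycle[x1 cxY] := cx.
have [y [y1 y2]] := aY _ cxY.
have xA : supported A x by apply: level_sub x1.
have [|l [u [u1 u2]]] := gz (restr B y).
  split; first exact: restr_upper.
  move=> t tB; rewrite bd_upper //; last exact: level_sub y1.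
  by rewrite y2 ?xA ?notAB // inE tB orbT.
have u1Y := supportedS (levelS _ BY) u1.
have [r1 r2] := cycle_bd cY u1Y.
exists l, (y - l *: z - restr Y (boundary u)); split.
  apply: supp_lower.
    by apply: supportedB => //; apply: supportedB => //; apply: supportedZ.
  move=> t tB; rewrite !chainB chainZ restrE inE tB orbT u2 // chainB chainZ restrE tB.
  by rewrite subrr.
move=> t tA; have tY : t \in Y by rewrite inE tA.
by rewrite !bdB r2 // bdZ y2 // subr0 chainB chainZ restrE tY.
Qed.

End Layers.

Lemma bd_simplex_face a t : a \notin t -> boundary (simplex F (a |: t)) t != 0.
Proof.
move=> nat_; rewrite boundary_simplex /simplex_boundary sum_ffunE.
rewrite (bigD1 a) ?setU11 //= big1 ?addr0.
  by rewrite chainZ ffunE setU1K // eqxx mulr1 signr_eq0.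
move=> v /andP[vs va]; rewrite chainZ ffunE.
case: (t =P _) => [et|_]; last by rewrite mulr0.
by move: nat_; rewrite et !inE eqxx eq_sym va.
Qed.

Lemma bd_simplex_size s t : #|s|.+1 != #|t| -> boundary (simplex F t) s = 0.
Proof.
move=> h; apply: bd_eq0 => u _ eu; rewrite ffunE.
by case: (u =P t) => // et; rewrite -eu et eqxx in h.
Qed.

(** Layers of a convex family are convex, so the exact sequences apply along
    the construction of the matching. *)
Theorem morse_acyclic k Y : morse k Y -> convex Y ->
  forall n, n \notin [seq #|c| | c : {set V} <- k] -> acyclic_at Y n.
Proof.
elim=> {k Y} [_ n _|t a at_ _ n _|t _ n|k l A B _ hA _ hB lAB cY n].
- move=> x [x1 _]; exists 0; split=> [t _|t]; last by rewrite inE.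
  by rewrite ffunE.
- move=> x [x1 x2]; pose e := boundary (simplex F (a |: t)) t.
  have e0 : e != 0 by apply: bd_simplex_face.
  have tu : #|a |: t| = #|t|.+1 by rewrite cardsU1 at_.
  have ut : a |: t != t by apply: contraNneq at_ => <-; apply: setU11.
  have xu : x (a |: t) = 0.
    have ex : x = x t *: simplex F t + x (a |: t) *: simplex F (a |: t).
      apply/ffunP => s; rewrite chainD !chainZ !ffunE.
      case: (eqVneq s t) => [->|st]; first by rewrite eq_sym (negPf ut) mulr0 mulr1 addr0.
      case: (eqVneq s (a |: t)) => [->|su]; first by rewrite mulr0 mulr1 add0r.
      by rewrite !mulr0 addr0 x1 // !inE (negPf st) (negPf su).
    have := x2 t; rewrite {1}ex bdD !bdZ bd_simplex_size ?mulr0 ?add0r; last first.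
      by rewrite neq_ltn ltnSn orbT.
    by rewrite !inE eqxx => /(_ isT)/eqP; rewrite mulf_eq0 (negPf e0) orbF => /eqP.
  exists (x t / e *: simplex F (a |: t)); split=> s.
    rewrite !inE chainZ ffunE; case: (eqVneq s (a |: t)) => [->|]; last by rewrite mulr0.
    rewrite orbT /= tu eqSS => tn; rewrite (x1 t) ?mul0r //.
    by rewrite !inE eqxx.
  rewrite !inE bdZ => /orP[] /eqP ->; first by rewrite divfK.
  by rewrite xu bd_simplex_size ?mulr0 // neq_ltn ltnSn orbT.
- rewrite inE => nt; move=> x [x1 x2]; exists 0; split=> s sS; first by rewrite ffunE.
  rewrite linear0 ffunE x1 // inE; move: sS; rewrite inE => /eqP ->.
  by rewrite eq_sym (negPf nt) andbF.
rewrite map_cat mem_cat negb_or => /andP[nk nl].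
apply: acyclic_union => //; first exact: hA (convex_lower lAB cY) _ nk.
exact: hB (convex_upper lAB cY) _ nl.
Qed.

Theorem morse_generator c Y : morse [:: c] Y -> convex Y ->
  exists z, generator Y #|c| z.
Proof.
move Ek: [:: c] => k m; elim: m Ek => {k Y} [//|//|t [<-] _|k l A B mA hA mB hB lAB Ek cY].
  exists (simplex F c); split.
  - split=> s; first by rewrite !inE ffunE; case: (eqVneq s c) => // -> /=; rewrite eqxx.
    by rewrite inE => /eqP ->; rewrite bd_simplex_size // neq_ltn ltnSn orbT.
  - move=> l y [y1 /(_ c (set11 _))]; rewrite chainZ ffunE eqxx mulr1 => <-.
    apply: bd_eq0 => s _ es; apply: y1; rewrite !inE; case: eqP => //= sc.
    by rewrite sc in es *; rewrite es eqSS neq_ltn ltnSn.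
  move=> x [x1 x2]; exists (x c), 0; split=> s; first by rewrite ffunE.
  rewrite inE => /eqP ->; rewrite linear0 chainB chainZ !ffunE eqxx mulr1 subrr //.
have cA := convex_lower lAB cY; have cB := convex_upper lAB cY.
case: k l mA hA mB hB Ek => [|c' k] l mA hA mB hB.
  rewrite cat0s => Ek; have [z hz] := hB Ek cB.
  apply: (generator_upper lAB cY _ hz) => m; exact: (morse_acyclic mA).
move=> [ec]; case: k mA hA => [|//] mA hA /= l0.
have [z hz] := hA (congr1 (cons^~ [::]) ec) cA.
rewrite -l0 in mB.
by exists z; apply: generator_lower => //; apply: (morse_acyclic mB).
Qed.

End Families.

(** * Comparison with reduced homology *)

Section Bridge.
Variables (F : fieldType) (V : finType) (X : simplicialComplex V).
Local Notation chain := (chain_space F V).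
Implicit Types (n : int) (m : nat) (x y : chain).

Lemma mem_chains n x : x \in chains F X n <-> supported (nfaces X n) x.
Proof.
split=> [h s sS|h].
  rewrite (coord_span (X := in_tuple _) h) sum_ffunE big1 // => i _.
  rewrite chainZ; have := mem_nth 0 (ltn_ord i).
  case/imageP => t tS ->; rewrite ffunE; case: eqP => [e|_]; last by rewrite mulr0.
  by rewrite e tS in sS.
have -> : x = \sum_(s in nfaces X n) x s *: simplex F s.
  apply/ffunP => t; rewrite sum_ffunE; case: (boolP (t \in nfaces X n)) => tS.
    rewrite (bigD1 t) //= chainZ ffunE eqxx mulr1 big1 ?addr0 // => s /andP[_ st].
    by rewrite chainZ ffunE eq_sym (negPf st) mulr0.
  rewrite h // big1 // => s sS; rewrite chainZ ffunE; case: eqP => [e|_]; last by rewrite mulr0.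
  by rewrite e sS in tS.
by apply: memv_suml => s sS; apply/memvZ/memv_span/imageP; exists s.
Qed.

Lemma nfaces_level n m : n + 1 = m%:Z -> nfaces X n = level X m.
Proof. by move=> e; apply/setP => s; rewrite !inE e eqz_nat. Qed.

Lemma mem_cycles n x : x \in cycles F X n <->
  supported (nfaces X n) x /\ boundary x = 0.
Proof.
rewrite memv_cap memv_ker lfunE /=; split.
  by case/andP => /mem_chains h /eqP.
by case=> /mem_chains -> ->; rewrite eqxx.
Qed.

Lemma bd_out n x s : supported (nfaces X n) x -> s \notin faces X -> boundary x s = 0.
Proof.
move=> h sX; apply: bd_eq0 => t st _; apply: h; rewrite inE.
by apply: contraNN sX => /andP[tX _]; apply: faces_closed tX st.
Qed.

Lemma cycle_cycles n m x : n + 1 = m%:Z -> cycle_in X m x <-> x \in cycles F X n.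
Proof.
move=> e; split=> [[x1 x2]|/mem_cycles]; last first.
  by rewrite (nfaces_level e) => -[x1 x2]; split=> // t _; rewrite x2 ffunE.
apply/mem_cycles; rewrite (nfaces_level e); split=> //.
apply/ffunP => t; rewrite ffunE; case: (boolP (t \in faces X)) => [/x2 //|].
by apply: (bd_out (n := n)); rewrite (nfaces_level e).
Qed.

Lemma bounds_boundaries n m x : n + 1 = m%:Z -> supported (nfaces X n) x ->
  (exists y, bounds X m y x) <-> x \in boundaries F X n.
Proof.
move=> e hx; have e' : n + 1 + 1 = m.+1%:Z by rewrite e -addn1 PoszD.
split=> [[y [y1 y2]]|/memv_imgP[y /mem_chains hy ->]].
  rewrite -(nfaces_level e') in y1.
  apply/memv_imgP; exists y; first exact/mem_chains.
  rewrite lfunE /=; apply/ffunP => t.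
  case: (boolP (t \in faces X)) => [/y2 //|tX].
  rewrite (bd_out y1) // hx // inE (negPf tX).
  by [].
exists y; split; first by rewrite -(nfaces_level e').
by move=> t _; rewrite lfunE.
Qed.

(** Naming the projection fixes the module structure of the target as that of
    [reduced_homology] rather than of a bare quotient. *)
Definition homology_class n (z : subvs_of (cycles F X n)) : reduced_homology F X n :=
  vquot_pi _ z.

Lemma homology_classP n (z : subvs_of (cycles F X n)) :
  homology_class z = 0 <-> vsval z \in boundaries F X n.
Proof.
rewrite /homology_class.
have <- : vquot_pi (linfun (@vsval F (chain_space F V) (cycles F X n))
    @^-1: boundaries F X n)%VS 0 = 0 by exact: raddf0.
split=> [/vquot_piP|h].
  by rewrite subr0 -memv_preim lfunE.
by apply/vquot_piP; rewrite subr0 -memv_preim lfunE.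
Qed.

Lemma homology_ind n (q : reduced_homology F X n) :
  exists z, q = homology_class z.
Proof. by exists (vquot_repr q); rewrite /homology_class vquot_reprK. Qed.

Lemma homology_trivial n :
    (forall m, n + 1 = m%:Z -> acyclic_at F X m) ->
  lmod_trivial (reduced_homology F X n).
Proof.
move=> acX q; have [z ->] := homology_ind q; apply/homology_classP.
have zc := subvsP z.
case e: (n + 1) => [m|m].
  have [zs _] := (mem_cycles _ _).1 zc.
  by apply/(bounds_boundaries e zs)/(acX m e)/(cycle_cycles _ e).
suff -> : vsval z = 0 by apply: mem0v.
apply/ffunP => s; have [-> //] := (mem_cycles _ _).1 zc; first by rewrite ffunE.
by rewrite inE e andbF.
Qed.

(** Each class is a multiple of that of [z] with a unique coefficient, which is
    the isomorphism. *)
Lemma homology_line n m z : n + 1 = m%:Z -> @generator F V X m z ->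
  lmod_iso (reduced_homology F X n) F^o.
Proof.
move=> e [cz nz gz]; have zc := (cycle_cycles z e).1 cz.
pose v := homology_class (Subvs zc).
have classZB (x : subvs_of (cycles F X n)) l :
    homology_class x - l *: v = homology_class (x - l *: Subvs zc).
  rewrite /v /homology_class raddfB; congr (_ - _).
  by apply/esym; apply: linearZ_LR.
have coef q : exists l, q == l *: v.
  have [x ->] := homology_ind q; have xc := subvsP x.
  have [l hl] := gz _ ((cycle_cycles _ e).2 xc); exists l.
  rewrite -subr_eq0 classZB; apply/eqP/homology_classP.
  have eB : vsval (x - l *: Subvs zc) = vsval x - l *: z by [].
  have [hs _] := (mem_cycles _ _).1 (subvsP (x - l *: Subvs zc)).
  by apply/(bounds_boundaries e hs); rewrite eB.
have v_free l : l *: v = 0 -> l = 0.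
  move=> lv; have : homology_class (0 - l *: Subvs zc) = 0.
    rewrite -classZB lv subr0; exact: raddf0.
  have [hs _] := (mem_cycles _ _).1 (subvsP (0 - l *: Subvs zc)).
  move=> /homology_classP/(bounds_boundaries e hs)[y hy].
  apply/eqP; rewrite -oppr_eq0; apply/eqP; apply: (nz (- l) y).
  suff -> : - l *: z = vsval (0 - l *: Subvs zc) by [].
  by rewrite sub0r scaleNr.
pose phi q : F^o := xchoose (coef q).
have phiE q : q = phi q *: v by apply/eqP; apply: (xchooseP (coef q)).
have phi_uniq q l : q = l *: v -> phi q = l.
  move=> ql; apply/eqP; rewrite -subr_eq0; apply/eqP/v_free.
  by rewrite scalerBl -phiE ql subrr.
have phi_lin : linear phi.
  move=> a p q; apply: phi_uniq.
  by rewrite scalerDl -phiE -scalerA -phiE.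
pose f := GRing.isLinear.Build F (reduced_homology F X n) F^o *:%R phi phi_lin.
pose g : {linear reduced_homology F X n -> F^o} := HB.pack phi f.
exists g; exists (fun l : F^o => l *: v) => [q|l]; first by rewrite -phiE.
exact: phi_uniq.
Qed.

End Bridge.

(** * Links and stars *)

Section Join.
Variables (F : fieldType) (V : finType) (r : {set V}).
Local Notation chain := (chain_space F V).
Implicit Types (x y : chain) (s t : {set V}) (L S : {set {set V}}).

Lemma bd_coface x t : boundary x t =
  \sum_(v | v \notin t) (-1) ^+ vpos (v |: t) v * x (v |: t).
Proof.
rewrite /boundary sum_ffunE.
pose T (s : {set V}) v : F := (-1) ^+ vpos s v * ((t == s :\ v)%:R * x s).
rewrite (eq_bigr (fun s => \sum_(v in s) T s v)); last first.
  move=> s _; rewrite chainZ sum_ffunE big_distrr /=; apply: eq_bigr => v _.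
  by rewrite chainZ ffunE mulrCA [x s * _]mulrC.
rewrite (exchange_big_dep predT) //= [RHS]big_mkcond; apply: eq_bigr => v _.
case: (boolP (v \in t)) => vt /=.
  rewrite big1 // => s vs; rewrite /T; case: (t =P _) => [et|_]; last by rewrite mul0r mulr0.
  by move: vt; rewrite et !inE eqxx.
rewrite (bigD1 (v |: t)) ?setU11 //= big1 ?addr0.
  by rewrite /T setU1K // eqxx mul1r.
move=> s /andP[vs st]; rewrite /T; case: (t =P _) => [et|_]; last by rewrite mul0r mulr0.
by move: st; rewrite et setD1K // eqxx.
Qed.

Definition shift (v : V) : nat := #|[set u in r | (enum_rank u < enum_rank v)%N]|.

(** Joining with [r] moves the position of [v] in the order of a simplex by
    [shift v]; these signs make the join commute with the boundary. *)
Definition join_sign t : F := \prod_(v in t) (-1) ^+ shift v.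

Lemma join_sign_sq t : join_sign t * join_sign t = 1.
Proof.
rewrite -big_split big1 //= => v _.
by rewrite -exprD addnn -muln2 exprM sqrr_sign.
Qed.

Lemma vpos_join t v : [disjoint t & r] -> v \notin r ->
  vpos (v |: (t :|: r)) v = (vpos (v |: t) v + shift v)%N.
Proof.
move=> tr vr; rewrite /vpos /shift -cardsUI.
rewrite (_ : _ :&: _ = set0) ?cards0 ?addn0; last first.
  apply/setP => u; rewrite !inE; apply/negP => /andP[/andP[/orP[/eqP ->|ut] _] /andP[ur _]].
    by rewrite ur in vr.
  by move: tr; rewrite -setI_eq0 => /eqP/setP/(_ u); rewrite !inE ut ur.
by apply: eq_card => u; rewrite !inE -andb_orl orbA.
Qed.

Lemma bd_join (x y : chain) t : [disjoint t & r] ->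
    (forall s, [disjoint s & r] -> y (s :|: r) = join_sign s * x s) ->
    (forall s, ~~ [disjoint s & r] -> x s = 0) ->
  boundary y (t :|: r) = join_sign t * boundary x t.
Proof.
move=> tr xy x0; rewrite !bd_coface big_distrr /= [RHS]big_mkcond [LHS]big_mkcond.
apply: eq_bigr => v _; rewrite in_setU negb_or.
case: (boolP (v \in t)) => //= vt; case: (boolP (v \in r)) => /= vr.
  rewrite x0 ?mulr0 //; rewrite -setI_eq0; apply/set0Pn; exists v.
  by rewrite !inE eqxx vr.
have dv : [disjoint v |: t & r].
  rewrite -setI_eq0 setIUl setU_eq0 !setI_eq0 tr andbT.
  by rewrite disjoints1.
have key (a b p q : F) : b * b = 1 -> (a * b) * ((b * p) * q) = p * (a * q).
  by move=> bb; transitivity ((b * b) * (p * (a * q))); [ring|rewrite bb mul1r].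
rewrite setUA xy // -setUA vpos_join // /join_sign big_setU1 //= exprD.
by apply: key; rewrite -exprD addnn -muln2 exprM sqrr_sign.
Qed.

(** The link [L] of [r] and the star [S] of [r], taken as the family of faces
    that contain [r], have the same homology up to a shift by [#|r|]. *)
Lemma acyclic_join L S n : (forall t, (t \in L) = [disjoint t & r] && (t :|: r \in S)) ->
    (forall s, s \in S -> r \subset s) ->
  acyclic_at F S (n + #|r|)%N -> acyclic_at F L n.
Proof.
move=> memL rS aS x [x1 x2].
have level_join t m : [disjoint t & r] ->
    (t :|: r \in level S (m + #|r|)%N) = (t \in level L m).
  move=> tr; rewrite !inE memL tr /=; congr andb.
  by rewrite cardsU (disjoint_setI0 tr) cards0 subn0 eqn_add2r.
have join_diff s : r \subset s -> (s :\: r) :|: r = s.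
  by move=> rs; rewrite setUC -{1}(setIidPr rs) setID.
have diff_disj s : [disjoint s :\: r & r].
  by rewrite -setI_eq0 setIDAC setDIl setDv setI0.
have diff_join t : [disjoint t & r] -> (t :|: r) :\: r = t.
  by move=> tr; rewrite setDUl setDv setU0; apply/setDidPl.
pose jx : chain := [ffun s : {set V} => if r \subset s then join_sign (s :\: r) * x (s :\: r) else 0].
have jxE t : [disjoint t & r] -> jx (t :|: r) = join_sign t * x t.
  by move=> tr; rewrite ffunE subsetUr diff_join.
have x0 t : ~~ [disjoint t & r] -> x t = 0.
  by move=> tr; apply: x1; rewrite inE memL (negPf tr).
have [|y [y1 y2]] := aS jx.
  split=> [s|s sS].
    rewrite ffunE; case: ifP => // rs; rewrite -{1}(join_diff s rs) level_join //.
    by move=> sL; rewrite x1 // mulr0.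
  rewrite -(join_diff s (rS s sS)) (bd_join (x := x)) //.
  by rewrite x2 ?mulr0 // memL diff_disj join_diff // rS.
pose x' : chain := [ffun t : {set V} => if [disjoint t & r] then join_sign t * y (t :|: r) else 0].
have x'E t : [disjoint t & r] -> x' t = join_sign t * y (t :|: r).
  by move=> tr; rewrite ffunE tr.
exists x'; split=> [t tL|t].
  rewrite ffunE; case: ifP => // tr; rewrite y1 ?mulr0 //.
  by rewrite -addSn level_join.
rewrite memL => /andP[tr tS].
have bx' : boundary y (t :|: r) = join_sign t * boundary x' t.
  apply: bd_join => // s sr; last by rewrite ffunE (negPf sr).
  by rewrite x'E // mulrA join_sign_sq mul1r.
have := bx'; rewrite y2 // jxE // => /(congr1 (fun q : F => join_sign t * q)).
by rewrite !mulrA join_sign_sq !mul1r.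
Qed.

End Join.

(** * Homology of the element-avoiding complex *)

Section AvoidingHomology.
Variables (F : fieldType) (V : finType) (O : orientedMatroid (option V)).
Implicit Types (U W r s t : {set V}) (m : nat).
Local Notation C := (avoiding_faces O).

(** For [r] empty this is the restriction of the complex to [W]. *)
Definition star r W : {set {set V}} :=
  [set s : {set V} | [&& s \in C, r \subset s & s \subset r :|: W]].

Lemma in_star r W s :
  (s \in star r W) = [&& s \in C, r \subset s & s \subset r :|: W].
Proof. by rewrite [LHS]in_set. Qed.

Lemma in_nonfaces W s : (s \in nonfaces O W) = (s \subset W) && (s \notin C).
Proof. by rewrite [LHS]in_set. Qed.

Lemma star0U W : star set0 W :|: nonfaces O W = powerset W.
Proof.
apply/setP => s; rewrite in_setU in_star in_nonfaces powersetE sub0set set0U /=.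
by case: (s \in C); rewrite /= ?andbF ?orbF ?andbT.
Qed.

Lemma star0_layered W : layered (star set0 W) (nonfaces O W).
Proof.
move=> s t; rewrite in_star => /andP[sC _]; rewrite in_nonfaces => /andP[_ tC].
by apply: contra tC; apply: avoiding_closed.
Qed.

Lemma powerset_convex W : convex (powerset W).
Proof. by move=> s t u _; rewrite !powersetE => uW _ tu; apply: subset_trans uW. Qed.

Lemma powerset_acyclic W m : W != set0 -> acyclic_at F (powerset W) m.
Proof.
case/set0Pn => w wW; apply: (@morse_acyclic _ _ [::]) => //; last exact: powerset_convex.
by apply: (morse_cone (a := w)) => s; rewrite !powersetE subUset sub1set wW.
Qed.

Lemma star0_convex W : convex (star set0 W :|: nonfaces O W).
Proof. by rewrite star0U; apply: powerset_convex. Qed.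

Lemma nonfaces_convex W : convex (nonfaces O W).
Proof. exact: convex_upper (@star0_layered W) (@star0_convex W). Qed.

(** Exact sequence of the full simplex on [W], which is acyclic. *)
Lemma star0_acyclic W m : W != set0 -> acyclic_at F (nonfaces O W) m.+1 ->
  acyclic_at F (star set0 W) m.
Proof.
move=> W0; apply: (acyclic_lower (@star0_layered W) (@star0_convex W)).
by rewrite star0U; apply: powerset_acyclic.
Qed.

Lemma rank_gt0 : set0 \in C -> (0 < om_rank O)%N.
Proof.
case/avoidingP => X XO [XN _]; rewrite -(cards1 (None : option V)); apply: rank_ge.
move=> Y YV /subsetP YN; apply: supp_eq0.
have Yu e : e != None -> Y e = SZero.
  by move=> eN; apply/eqP; apply: contraNT eN => Ye; rewrite -in_set1 YN ?inE.
move=> e; case: (eqVneq e None) => [->|/Yu //].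
have [||//] := svorth_at (e := None) (vectorsP _ _ YV X XO); last by rewrite XN.
by move=> f /Yu; right.
Qed.

(** A critical cell of the non-faces has as many elements as an independent
    set, hence at most as many as the rank, and affects only the level below
    its own. *)
Lemma star0_acyclic_rank W m : (om_rank O <= m)%N -> acyclic_at F (star set0 W) m.
Proof.
move=> km; have [W0|W0] := eqVneq W set0.
  move=> x [x1 _]; exists 0; split=> [t _|t tS]; first by rewrite ffunE.
  move: tS; rewrite in_star W0 setU0 subset0 => /and3P[tC _ /eqP t0].
  have m0 : (0 < m)%N by apply: leq_trans km; apply: rank_gt0; rewrite -t0.
  rewrite linear0 ffunE x1 //; apply/negP; rewrite [_ \in _]in_set => /andP[_].
  by rewrite t0 cards0 eq_sym (gtn_eqF m0).
apply: star0_acyclic => //; case: (boolP (bounded O W)) => [bW|nb].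
  have [c [D [[mc cD _] [ind _]]]] := nonfaces_bounded bW.
  apply: (morse_acyclic mc); first exact: nonfaces_convex.
  have := rank_ge ind; rewrite mem_seq1 cD => /leq_trans/(_ km) lt.
  by rewrite neq_ltn ltnS lt orbT.
exact: (morse_acyclic (nonfaces_unbounded W0 nb) (@nonfaces_convex W)).
Qed.

(** The faces between [r :\ v] and [r :|: W] are split by whether they contain
    [v]; both the whole and the part without [v] are instances with a smaller
    [r]. *)
Lemma star_acyclic_rank r W m : [disjoint r & W] -> (om_rank O <= m)%N ->
  acyclic_at F (star r W) (m + #|r|)%N.
Proof.
move En: #|r| => n; elim: n r En W m => [|n IH] r En W m rW km.
  by rewrite (cards0_eq En) addn0; apply: star0_acyclic_rank.
have [v vr] : exists v, v \in r by apply/set0Pn; rewrite -cards_eq0 En.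
have En' : #|r :\ v| = n by move: En; rewrite (cardsD1 v) vr add1n => -[].
have vW : v \notin W by rewrite (disjointFr rW vr).
have rvW : (r :\ v) :|: (v |: W) = r :|: W.
  by rewrite setUCA setUA setD1K.
have eU : star (r :\ v) W :|: star r W = star (r :\ v) (v |: W).
  apply/setP => s; rewrite in_setU !in_star rvW.
  case: (boolP (s \in C)) => //= _.
  case: (boolP (v \in s)) => vs.
    have -> : (s \subset (r :\ v) :|: W) = false.
      apply/negbTE/subsetPn; exists v => //.
      by rewrite !inE eqxx (negPf vW).
    by rewrite andbF /= -[in r \subset s](setD1K vr) subUset sub1set vs.
  have -> : (r \subset s) = false by apply/negbTE/subsetPn; exists v.
  rewrite orbF; congr andb; apply/subsetP/subsetP => h x xs.
    by have := h x xs; rewrite !inE => /orP[/andP[_ ->]|->]; rewrite ?orbT.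
  have := h x xs; rewrite !inE; case: (eqVneq x v) => // xv.
  by rewrite -xv xs in vs.
have dW : [disjoint r :\ v & W] by apply: disjointWl rW; apply: subsetDl.
rewrite addnS; apply: (@acyclic_upper _ _ (star (r :\ v) W)).
- move=> s t; rewrite !in_star => /and3P[_ _ sW] /and3P[_ rt _].
  apply/negP => ts; have := subsetP sW v (subsetP ts v (subsetP rt v vr)).
  by rewrite !inE eqxx (negPf vW).
- rewrite eU => s t u; rewrite !in_star => /and3P[_ rs _] /and3P[uC _ uW] st tu.
  by rewrite (avoiding_closed uC tu) (subset_trans rs st) (subset_trans tu uW).
- exact: IH.
rewrite eU -addSn; apply: IH => //; last exact: leqW.
apply/pred0P => x; rewrite /= !inE; case: (eqVneq x v) => //= _.
by have /pred0P/(_ x) := rW.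
Qed.

Lemma ground0_setT e : e \in ground0 [set: V].
Proof. by case: e => [u|]; rewrite in_setU1 ?in_ground ?in_setT. Qed.

(** A strictly positive covector is not orthogonal to a nonzero nonnegative
    vector on [V].  A vector that is nonzero at a given element exists by
    painting, as the covector in the other alternative is excluded by the
    second hypothesis. *)
Lemma bounded_setT : Bcap O SPos (ground setT) != set0 ->
    Dcap O SPos (ground setT) :&: Dset O SNeg None = [set svzero (option V)] ->
  bounded O setT.
Proof.
move=> /set0Pn[X /in_Bcap[XO XV]] D0; apply/andP; split; last first.
  apply/forall_inP => Y /in_dual_minor[YV YT]; apply/implyP => nY; apply/implyP => /eqP YN.
  have o := vectorsP _ _ YV X XO.
  apply/eqP/supp_eq0 => -[u|//].
  have [||] := svorth_agree (Some u) o; rewrite ?flipN ?XV //.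
  move=> [w|]; rewrite ?flipN ?flipN0 ?YN ?XV //; last by right; left.
  by have /nonnegP/(_ (Some w)) := nY; case: (Y _); tauto.
have [T [TM nT Tmax]] := nonneg_top (dual_minor O setT).
apply/exists_inP; exists T => //; rewrite nT; apply/subsetP => e _.
pose sigma : signvec (option V) := [ffun f => if f is Some _ then SPos else SNeg].
have sE f : sigma f = if f is Some _ then SPos else SNeg by rewrite ffunE.
have se f : sigma f != SZero by rewrite sE; case: f.
have [/exists_inP[Y YO /andP[/eqP Ye /agreesP Ya]]|no] := boolP
    [exists Phi in O, (Phi e == sigma e) && agrees sigma (supp sigma) Phi].
  have : Y \in Dcap O SPos (ground setT) :&: Dset O SNeg None.
    apply/setIP; split.
      apply/in_Dcap; split=> // u _.
      by have [|->|->] := Ya (Some u); rewrite ?inE // sE.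
    rewrite inE YO /=.
    by have [|->|->] := Ya None; rewrite ?inE // sE.
  rewrite D0 inE => /eqP Y0; move: (se e); rewrite -Ye Y0 ffunE //.
have [Y YV [Ye /agreesP Ya]] := painting0 (se e) no.
have YM : flip [set None] Y \in dual_minor O setT.
  by apply/in_dual_minor; rewrite flipK; split=> // f; rewrite ground0_setT.
apply: (subsetP (Tmax _ YM _)).
  apply/nonnegP => -[u|]; rewrite ?flipN ?flipN0.
    by have [|->|->] := Ya (Some u); rewrite ?inE // sE.
  by have [|->|->] := Ya None; rewrite ?inE // sE.
by rewrite inE flipE; case: ifP; rewrite ?sopp_eq0 Ye.
Qed.

(** In the first case painting gives, for some element of [V], a nonnegative
    vector on [V] through it, which is a recession direction.  In the second
    case a nonzero covector that is nonnegative on [V] and not plus at the base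
    element agrees everywhere with an interior point of the dual cone, to which
    it should be orthogonal. *)
Lemma unbounded_setT : Bcap O SPos (ground setT) = set0 \/
    Dcap O SPos (ground setT) :&: Dset O SNeg None != [set svzero (option V)] ->
  ~~ bounded O setT.
Proof.
move=> hyp; apply/negP => /andP[/exists_inP[T TM /andP[nT WT]] /forall_inP rec].
case: hyp => [B0|/negP[]]; last first.
  apply/eqP/setP => X; rewrite in_set1; apply/idP/eqP => [|->]; last first.
    apply/setIP; split; last by rewrite inE covector0 ffunE.
    by apply/in_Dcap; split=> [|u _]; rewrite ?covector0 ?ffunE.
  case/setIP => /in_Dcap[XO Xu]; rewrite inE => /andP[_ XN].
  have Tpos e : T e = SPos.
    apply: nonneg_pos => //; have := subsetP WT e (ground0_setT e).
    by rewrite inE.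
  have /in_dual_minor[TV _] := TM; have o := vectorsP _ _ TV X XO.
  apply: supp_eq0 => e.
  have [|//|] := svorth_agree e o; last by rewrite flipE Tpos; case: ifP.
  move=> [u|]; rewrite ?flipN ?flipN0 Tpos.
    by have := Xu u (in_setT u); case: (X _) => // _; tauto.
  by move: XN => /orP[] /eqP ->; tauto.
pose sigma : signvec (option V) := [ffun f => if f is Some _ then SPos else SZero].
have sE f : sigma f = if f is Some _ then SPos else SZero by rewrite ffunE.
have [X [XO /agreesP Xa Xmax]] := max_agreeing sigma (supp sigma)
  (covector0 O) (@covector_comp _ O).
have ss u : Some u \in supp sigma by rewrite inE sE.
suff : X \in Bcap O SPos (ground setT) by rewrite B0 inE.
apply/in_Bcap; split=> // u _.
have [|XN] := Xa (Some u) (ss u); last by rewrite XN sE.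
move=> X0.
have [/exists_inP[Y YO /andP[/eqP Yu Ya]]|no] := boolP
    [exists Phi in O, (Phi (Some u) == sigma (Some u)) && agrees sigma (supp sigma) Phi].
  have := Xmax Y (Some u) YO Ya (ss u); rewrite Yu X0 sE eqxx => /(_ isT) //.
have [|Y YV [Yu /agreesP Ya]] := painting0 _ no; first by rewrite sE.
have YN : Y None = SZero by have [|//|->] := Ya None; rewrite ?inE // sE.
have fY : flip [set None] Y = Y.
  by apply/ffunP => f; rewrite flipE !inE; case: eqP => // ->; rewrite YN.
have YM : Y \in dual_minor O setT.
  by apply/in_dual_minor; rewrite fY; split=> // f; rewrite ground0_setT.
have nY : nonneg Y.
  by apply/nonnegP => -[w|]; rewrite ?YN //; have [|->|->] := Ya (Some w); rewrite ?inE ?sE.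
have /implyP/(_ nY)/implyP := rec Y YM; rewrite YN eqxx => /(_ isT)/eqP Y0.
by move: Yu; rewrite Y0 sE ffunE.
Qed.

End AvoidingHomology.

Theorem corollary5p11 (F : fieldType) (V : finType) (hV : (0 < #|V|)%N)
    (O : orientedMatroid (option V)) (k : nat) (hk : om_rank O = k)
    (U : {set V}) :
  [/\ Bcap O SPos (ground [set: V]) != set0 ->
      Dcap O SPos (ground [set: V]) :&: Dset O SNeg None
        = [set svzero (option V)] ->
      (forall n : int, n != k%:Z - 2 ->
         lmod_trivial (reduced_homology F (avoiding O) n)) /\
      lmod_iso (reduced_homology F (avoiding O) (k%:Z - 2)) F^o,
      Bcap O SPos (ground [set: V]) = set0 \/
      Dcap O SPos (ground [set: V]) :&: Dset O SNeg None
        != [set svzero (option V)] ->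
      forall n : int, lmod_trivial (reduced_homology F (avoiding O) n),
      Dcap O SPos (ground (~: U)) :&: Bset O SNeg None = set0 ->
      forall n : int,
        lmod_trivial (reduced_homology F (link (avoiding O) (~: U)) n)
    & Dcap O SPos (ground (~: U)) :&: Bset O SNeg None != set0 ->
      forall n : int, k%:Z - 1 <= n ->
        lmod_trivial (reduced_homology F (link (avoiding O) (~: U)) n)].
Proof.
have V0 : [set: V] != set0 by rewrite -card_gt0 cardsT.
have starT : star O set0 setT = faces (avoiding O).
  by apply/setP => s; rewrite in_star sub0set set0U subsetT !andbT.
split.
- move=> B0 D0.
  have bT := bounded_setT B0 D0.
  have [c [D [[mc cD DW] [ind span]]]] := nonfaces_bounded bT.
  have ck : #|c| = k.
    rewrite -cD -hk; apply/eqP; rewrite eqn_leq rank_ge //=.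
    apply: rank_le => X XO XD; apply: supp_eq0 => e; apply: (span X) => //.
    exact: ground0_setT.
  split=> [n nk|].
    apply: homology_trivial => m em; rewrite -starT; apply: star0_acyclic => //.
    apply: (morse_acyclic mc); first exact: nonfaces_convex.
    by rewrite mem_seq1 ck; apply: contraNneq nk; lia.
  have [k0 ek] : exists k0, k = k0.+1.
    have /set0Pn[X /in_Bcap[XO XV]] := B0; have [v _] := set0Pn _ V0.
    case: k hk ck => [|k0] hk ck; last by exists k0.
    have D_0 : D = set0 by apply/eqP; rewrite -cards_eq0 cD ck.
    have := span X XO; rewrite D_0 => /(_ _ (Some v) (ground0_setT _)).
    rewrite XV ?inE // => h; suff: SPos = SZero by [].
    by apply: h; apply/vanishesP => e; rewrite inE.
  have [z hz] := morse_generator F mc (@nonfaces_convex _ O setT).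
  rewrite ck ek in hz.
  apply: (@homology_line _ _ _ _ k0); first by rewrite ek; lia.
  rewrite -starT; apply: (generator_connect (@star0_layered _ O setT)
    (@star0_convex _ O setT) _ _ hz); rewrite star0U; exact: powerset_acyclic.
- move=> hyp; have nb := unbounded_setT hyp.
  move=> n; apply: homology_trivial => m em; rewrite -starT; apply: star0_acyclic => //.
  exact: (morse_acyclic (nonfaces_unbounded V0 nb) (@nonfaces_convex _ O setT)).
- move=> D0 n; apply: homology_trivial => m em x [x1 x2]; exists 0.
  have noC : ~: U \notin avoiding_faces O by rewrite avoiding_DB D0 eqxx.
  have noL t : t \in faces (link (avoiding O) (~: U)) -> False.
    rewrite in_set => /and3P[_ _ tU]; move/negP: noC; apply.
    by apply: avoiding_closed tU _; apply: subsetUr.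
  by split=> t => [_|/noL //]; rewrite ffunE.
- move=> _ n kn; apply: homology_trivial => m em.
  apply: (@acyclic_join _ _ (~: U) _ (star O (~: U) U)).
  + move=> t; rewrite [LHS]in_set in_star setI_eq0 (setUC (~: U) U) setUCr subsetT subsetUr !andbT.
    case: (boolP (t :|: ~: U \in avoiding_faces O)) => tC; last by rewrite !andbF.
    by rewrite (avoiding_closed tC) ?subsetUl.
  + by move=> s; rewrite in_star => /and3P[].
  apply: star_acyclic_rank; first by rewrite -setI_eq0 setIC setICr.
  by rewrite hk; lia.
Qed.
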